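(* Let $\mathfrak{A}$ be a unital $\mathrm{C}^*$-algebra and let $\mathfrak{B}\subset\mathfrak{A}$ be a unital separable $\mathrm{C}^*$-subalgebra with the weak expectation property. Let $a\in\mathfrak{A}$ be a self-adjoint element and let $\varepsilon>0$. Then, there is a sequence $(\beta_n)_n$ of self-adjoint elements in $\mathfrak{B}$ with the following properties. (1) We have $\|\beta_n\|\le(1+\varepsilon)\|a\|$ for every $n\in\mathbb{N}$ and $$\limsup_{n\to\infty}\|\beta_n\|\le\|a\|.$$ (2) We have $$\limsup_{n\to\infty}\psi(\beta_n)\le\inf\{\psi(b):b\in\mathfrak{B},\ b\ge a\}$$ and $$\sup\{\psi(c):c\in\mathfrak{B},\ c\le a\}\le\liminf_{n\to\infty}\psi(\beta_n)$$ for every state $\psi$ on $\mathfrak{B}$.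
   Context: A $\mathrm{C}^*$-algebra $\mathfrak{B}$ has the weak expectation property if for every injective $*$-representation $\pi:\mathfrak{B}\to B(\mathcal{H}_\pi)$ there is a unital completely positive map $E_\pi:B(\mathcal{H}_\pi)\to\pi(\mathfrak{B})''$ satisfying $E_\pi(\pi(b))=\pi(b)$ for every $b\in\mathfrak{B}$. A unital $\mathrm{C}^*$-subalgebra of $\mathfrak{A}$ contains the unit of $\mathfrak{A}$. *)

(* Defs.v *)
From HB Require Import structures.
From mathcomp Require Import all_boot all_order all_algebra.
From mathcomp Require Import complex.
From mathcomp Require Import all_classical all_reals all_analysis.
Set Implicit Arguments.
Unset Strict Implicit.
Unset Printing Implicit Defensive.
Import Order.TTheory GRing.Theory Num.Theory.
Import numFieldNormedType.Exports.
Local Open Scope classical_set_scope.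
Local Open Scope ring_scope.


(* Unital C*-algebras over R[i].  The library's hierarchy admits no join of rings
   and normed modules outside [numDomainType], so the norm is a real-valued field
   of the structure, and convergence, density and norm-closedness are expressed
   with it.  As in [algType], the zero algebra is excluded. *)
HB.mixin Record isCStarAlgebra (R : realType) A & GRing.Algebra R[i] A := {
  star : A -> A ;
  star_antilinear : forall (k : R[i]) (x y : A),
    star (k *: x + y) = Num.conj k *: star x + star y ;
  starM : forall x y : A, star (x * y) = star y * star x ;
  starK : involutive star ;
  cnorm : A -> R ;
  ler_cnormD : forall x y : A, cnorm (x + y) <= cnorm x + cnorm y ;
  cnormZ : forall (k : R[i]) (x : A), cnorm (k *: x) = complex.Re `|k| * cnorm x ;
  cnorm0_eq0 : forall x : A, cnorm x = 0 -> x = 0 ;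
  ler_cnormM : forall x y : A, cnorm (x * y) <= cnorm x * cnorm y ;
  cnorm_starM : forall x : A, cnorm (star x * x) = cnorm x ^+ 2 ;
  cnorm_complete : forall u : nat -> A,
    (forall e : R, 0 < e -> exists N, forall m n, (N <= m)%N -> (N <= n)%N ->
       cnorm (u m - u n) < e) ->
    exists l : A, cnorm (u n - l) @[n --> \oo] --> (0 : R)
}.

#[short(type="cstarType")]
HB.structure Definition CStarAlgebra (R : realType) :=
  {A of GRing.Algebra R[i] A & isCStarAlgebra R A}.

Section CStarNotions.
Variables (R : realType) (A : cstarType R).

Definition selfadjoint (x : A) : Prop := star x = x.

Definition cstar_pos (x : A) : Prop := exists y : A, x = star y * y.

Definition cstar_le (x y : A) : Prop := cstar_pos (y - x).

Definition cstar_separable : Prop :=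
  exists2 D : set A, countable D &
    forall (x : A) (e : R), 0 < e -> exists2 d, D d & cnorm (x - d) < e.

Definition is_state (psi : {scalar A}) : Prop :=
  (forall x : A, cstar_pos x -> 0 <= psi x) /\ psi 1 = 1.

End CStarNotions.

(* [GRing.subalg_closed] includes 1 \in S: the subalgebra contains the unit of
   the ambient algebra. *)
Record cstarSubalg (R : realType) (A : cstarType R) := CStarSubalg {
  subalg_pred :> {pred A} ;
  subalg_predP : GRing.subalg_closed subalg_pred ;
  subalg_star : forall x, x \in subalg_pred -> star x \in subalg_pred ;
  subalg_normclosed : forall (u : nat -> A) (l : A),
    (forall n, u n \in subalg_pred) ->
    cnorm (u n - l) @[n --> \oo] --> (0 : R) -> l \in subalg_pred
}.

Section SubalgebraType.
Variables (R : realType) (A : cstarType R) (B : cstarSubalg A).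

Record subalg := SubalgElt {
  subalg_val : A ;
  subalg_valP : subalg_val \in subalg_pred B
}.

HB.instance Definition _ := [isSub for subalg_val].
HB.instance Definition _ := [Choice of subalg by <:].

HB.instance Definition _ :=
  GRing.isSubalgClosed.Build R[i] A (subalg_pred B)
    (GRing.subalg_closed_semi (subalg_predP B)).
HB.instance Definition _ :=
  [SubChoice_isSubAlgebra of subalg by <:].

Definition subalg_starelt (x : subalg) : subalg :=
  SubalgElt (subalg_star (subalg_valP x)).
Definition subalg_norm (x : subalg) : R := cnorm (val x).

Fact subalg_star_antilinear (k : R[i]) (x y : subalg) :
  subalg_starelt (k *: x + y) =
  Num.conj k *: subalg_starelt x + subalg_starelt y.
Proof. by apply: val_inj; rewrite /= star_antilinear. Qed.

Fact subalg_starM (x y : subalg) :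
  subalg_starelt (x * y) = subalg_starelt y * subalg_starelt x.
Proof. by apply: val_inj; rewrite /= starM. Qed.

Fact subalg_starK : involutive subalg_starelt.
Proof. by move=> x; apply: val_inj; rewrite /= starK. Qed.

Fact ler_subalg_normD (x y : subalg) :
  subalg_norm (x + y) <= subalg_norm x + subalg_norm y.
Proof. exact: ler_cnormD. Qed.

Fact subalg_normZ (k : R[i]) (x : subalg) :
  subalg_norm (k *: x) = complex.Re `|k| * subalg_norm x.
Proof. exact: cnormZ. Qed.

Fact subalg_norm0_eq0 (x : subalg) : subalg_norm x = 0 -> x = 0.
Proof. by move=> /cnorm0_eq0 x0; apply: val_inj. Qed.

Fact ler_subalg_normM (x y : subalg) :
  subalg_norm (x * y) <= subalg_norm x * subalg_norm y.
Proof. exact: ler_cnormM. Qed.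

Fact subalg_norm_starM (x : subalg) :
  subalg_norm (subalg_starelt x * x) = subalg_norm x ^+ 2.
Proof. exact: cnorm_starM. Qed.

Fact subalg_complete (u : nat -> subalg) :
  (forall e : R, 0 < e -> exists N, forall m n, (N <= m)%N -> (N <= n)%N ->
     subalg_norm (u m - u n) < e) ->
  exists l : subalg, subalg_norm (u n - l) @[n --> \oo] --> (0 : R).
Proof.
move=> cu; have [l ul] := @cnorm_complete R A (fun n => val (u n)) cu.
have Bl : l \in subalg_pred B.
  by apply: subalg_normclosed ul => n; exact: subalg_valP.
by exists (SubalgElt Bl).
Qed.

HB.instance Definition _ := isCStarAlgebra.Build R subalg
  subalg_star_antilinear subalg_starM subalg_starK ler_subalg_normD
  subalg_normZ subalg_norm0_eq0 ler_subalg_normM subalg_norm_starM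
  subalg_complete.
End SubalgebraType.

(* The inner product is linear in its first argument. *)
HB.mixin Record isHilbert (R : realType) H & CompleteNormedModule R[i] H := {
  hdot : {dot H for (@Num.conj R[i])} ;
  hdotE : forall x : H, hdot x x = `|x| ^+ 2
}.

#[short(type="hilbertType")]
HB.structure Definition Hilbert (R : realType) :=
  {H of CompleteNormedModule R[i] H & isHilbert R H}.

Section Operators.
Variables (R : realType) (H : hilbertType R).

(* B(H); for linear maps continuity is boundedness. *)
Definition bounded_op : set (H -> H) := [set T | linear T /\ continuous T].

Definition commutant (S : set (H -> H)) : set (H -> H) :=
  [set T | bounded_op T /\ forall s, S s -> T \o s = s \o T].

Definition bicommutant (S : set (H -> H)) : set (H -> H) :=
  commutant (commutant S).

(* Positivity of the operator matrix (T i j) acting on H^n. *)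
Definition opmx_pos (n : nat) (T : 'I_n -> 'I_n -> H -> H) : Prop :=
  forall v : 'I_n -> H, 0 <= \sum_i \sum_j hdot (T i j (v j)) (v i).

(* Unital completely positive maps B(H) -> B(H); the values of E outside B(H)
   are irrelevant. *)
Definition ucp (E : (H -> H) -> (H -> H)) : Prop :=
  [/\ forall T, bounded_op T -> bounded_op (E T),
      forall (k : R[i]) S T, bounded_op S -> bounded_op T ->
        E (k *: S + T) = k *: E S + E T,
      forall (n : nat) (T : 'I_n -> 'I_n -> H -> H),
        (forall i j, bounded_op (T i j)) -> opmx_pos T ->
        opmx_pos (fun i j => E (T i j))
    & E idfun = idfun].

Definition star_rep (B : cstarType R) (pi : B -> H -> H) : Prop :=
  [/\ forall b, bounded_op (pi b),
      forall (k : R[i]) b c, pi (k *: b + c) = k *: pi b + pi c,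
      forall b c, pi (b * c) = pi b \o pi c
    & forall b x y, hdot (pi b x) y = hdot x (pi (star b) y)].

End Operators.

Definition weak_expectation_property (R : realType) (B : cstarType R) : Prop :=
  forall (H : hilbertType R) (pi : B -> H -> H),
    star_rep pi -> injective pi ->
    exists E : (H -> H) -> (H -> H),
      [/\ ucp E,
          forall T, bounded_op T -> bicommutant (range pi) (E T)
        & forall b, E (pi b) = pi b].

(* Main.v *)
Require Import Defs.
From HB Require Import structures.
From mathcomp Require Import all_boot all_order all_algebra sesquilinear.
From mathcomp Require Import complex.
From mathcomp Require Import all_classical all_reals all_analysis.
From mathcomp Require Import ring lra.
Set Implicit Arguments.
Unset Strict Implicit.
Unset Printing Implicit Defensive.
Import Order.TTheory GRing.Theory Num.Theory.
Import numFieldNormedType.Exports.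
Local Open Scope classical_set_scope.
Local Open Scope ring_scope.

(** Everything rests on a finite interpolation statement ([interpolation]): if
    [d_i] are finitely many elements of [B], [s_i] are real numbers (in the
    application, signs) and [s_i (d_i - a) >= 0] for all [i], then for every
    [delta > 0] some self-adjoint [beta] in [B] satisfies
    [s_i (d_i - beta) + delta >= 0] for all [i].  Elements of [B] above [a] have
    sign [1], elements below [a] have sign [-1].  As [B] is separable, countably
    many bounds are dense among all bounds of [a] in [B] ([dense_bounds]); the
    [n]-th term of the sequence interpolates the first of these within an error
    that tends to zero, and states, being contractive, carry the inequalities
    to all bounds.  The scalars [|a|] and [-|a|] are always included: order
    bounds by scalars are norm bounds ([pcone_cnorm_le]), so the norm estimate
    comes for free.

    Interpolation is proved by duality.  If no [beta] exists, separating a point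
    from a cone ([cone_separation]) gives positive functionals [phi_i] on [A]
    with [sum_i s_i phi_i = 0] on [B] and [sum_i s_i phi_i(d_i) < 0].  Were [a]
    an element of [B], the sum would equal [sum_i phi_i(s_i (d_i - a)) >= 0].
    The weak expectation supplies a substitute for [a]
    ([balanced_posfun_ge0]).  Let [tau] be a positive functional that is faithful
    on [B], which exists by separability, and let [pi] be the representation of
    [B] given by [omega = sum_i phi_i + tau]; it is injective.  Compressing [a] to
    its space [H] gives an operator [T] with [s_i (pi(d_i) - T) >= 0], and a weak
    expectation moves [T] to some [X] in the bicommutant of [pi(B)] with
    [z_i = s_i (pi(d_i) - X) >= 0].  Because [phi_i <= omega], there are positive
    operators [h_i] in the commutant with [phi_i(b) = <h_i pi(b) xi, xi>].  They
    commute with [X], so [<h_i z_i xi, xi> >= 0]; summing over [i], the terms in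
    [X] cancel, since [sum_i s_i h_i xi] is orthogonal to the dense set [pi(B) xi],
    and what is left is [sum_i s_i phi_i(d_i) >= 0].

    Two constructions carry this argument.  The Hilbert space is the space of
    bounded antilinear functionals on [B]; density of [B] in it comes from
    minimising a quadratic functional ([ip_dense]), and then bounded forms extend
    to operators at once ([form_operator]).  Positivity in a C*-algebra is the
    norm condition [pcone], whose agreement with [x = y' y] ([y'] the adjoint)
    is Kaplansky's theorem [pcone_starM], proved without spectral theory from a
    square root obtained by iteration ([sqrt_one_sub]). *)

(** * Linear identities in a module *)

(** A linear identity in a module is an equality of coefficients, atom by atom;
    products in a noncommutative algebra, once expanded, count as atoms. *)

Section LinearIdentities.
Variables (K : comNzRingType) (V : lmodType K).

Inductive lterm :=
  | LVar of nat | LZero | LAdd of lterm & lterm | LOpp of lterm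
  | LScale of K & lterm.

Fixpoint leval (e : seq V) t : V :=
  match t with
  | LVar n => e`_n
  | LZero => 0
  | LAdd t1 t2 => leval e t1 + leval e t2
  | LOpp t1 => - leval e t1
  | LScale k t1 => k *: leval e t1
  end.

Fixpoint lcoef (t : lterm) (i : nat) : K :=
  match t with
  | LVar n => if Nat.eqb n i then 1 else 0
  | LZero => 0
  | LAdd t1 t2 => lcoef t1 i + lcoef t2 i
  | LOpp t1 => - lcoef t1 i
  | LScale k t1 => k * lcoef t1 i
  end.

Fixpoint lcoef_eq (t1 t2 : lterm) (n : nat) : Prop :=
  match n with
  | 0%N => True
  | m.+1 => lcoef t1 m = lcoef t2 m /\ lcoef_eq t1 t2 m
  end.

Lemma levalE e t : leval e t = \sum_(i < size e) lcoef t i *: e`_i.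
Proof.
elim: t => [n||t1 IH1 t2 IH2|t IH|k t IH] /=.
- have E i : (if Nat.eqb n i then 1 else 0 : K) = (n == i)%:R.
    by rewrite (_ : Nat.eqb n i = (n == i)) //; case: (n == i).
  have [lt|ge] := ltnP n (size e).
    rewrite (bigD1 (Ordinal lt)) //= big1 ?addr0 ?E ?eqxx ?scale1r // => i ni.
    rewrite E (_ : (n == i) = false) ?scale0r //.
    by apply/negbTE; apply: contra ni => /eqP ni; apply/eqP/val_inj.
  rewrite nth_default // big1 // => i _; rewrite E (_ : (n == i) = false) ?scale0r //.
  by apply/negbTE; rewrite neq_ltn (leq_trans (ltn_ord i) ge) orbT.
- by rewrite big1 // => i _; rewrite scale0r.
- by rewrite IH1 IH2 -big_split; apply: eq_bigr => i _; rewrite scalerDl.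
- by rewrite IH -sumrN; apply: eq_bigr => i _; rewrite scaleNr.
- by rewrite IH scaler_sumr; apply: eq_bigr => i _; rewrite scalerA.
Qed.

Lemma leval_eq e t1 t2 : lcoef_eq t1 t2 (size e) -> leval e t1 = leval e t2.
Proof.
move=> h; rewrite !levalE; apply: eq_bigr => -[i lt] _ /=; congr (_ *: _).
move: (size e) lt h => n; elim: n => // n IH; rewrite ltnS leq_eqVlt.
by case/orP=> [/eqP -> []//|lt [_]]; exact: IH.
Qed.

End LinearIdentities.

(* Atoms are compared up to conversion: the same product may be reached through
   different algebraic structures. *)
Ltac lmod_find e x :=
  lazymatch e with
  | ?y :: ?e' =>
    match goal with
    | _ => let _ := match goal with _ => unify x y end in constr:(0%N)
    | _ => let n := lmod_find e' x in constr:(n.+1)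
    end
  end.

Ltac lmod_atoms e t :=
  lazymatch t with
  | (?x + ?y)%R => let e1 := lmod_atoms e x in lmod_atoms e1 y
  | (- ?x)%R => lmod_atoms e x
  | (?k *: ?x)%R => lmod_atoms e x
  | 0%R => e
  | _ => match e with
         | _ => let n := lmod_find e t in e
         | _ => constr:(t :: e)
         end
  end.

Ltac lmod_reify K e t :=
  lazymatch t with
  | (?x + ?y)%R => let a := lmod_reify K e x in let b := lmod_reify K e y in
      constr:(@LAdd K a b)
  | (- ?x)%R => let a := lmod_reify K e x in constr:(@LOpp K a)
  | (?k *: ?x)%R => let a := lmod_reify K e x in constr:(@LScale K k a)
  | 0%R => constr:(@LZero K)
  | _ => let n := lmod_find e t in constr:(@LVar K n)
  end.

Ltac lmod_over K :=
  lazymatch goal with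
  | |- @eq ?V ?x ?y =>
    let e0 := constr:(@nil V) in
    let e1 := lmod_atoms e0 x in
    let e := lmod_atoms e1 y in
    let a := lmod_reify K e x in
    let b := lmod_reify K e y in
    apply: (@leval_eq K _ e a b); rewrite /=; do ?split; ring
  end.

Local Notation Re := complex.Re.
Local Notation Im := complex.Im.

(** * Complex numbers with real-valued modulus *)

Section ComplexModulus.
Variable R : realType.
Implicit Types (z w : R[i]) (t : R).

Definition cabs z : R := Re `|z|.

Lemma cabsE z : `|z| = (cabs z)%:C%C.
Proof. by rewrite /cabs normc_def. Qed.

Lemma cabs_ge0 z : 0 <= cabs z.
Proof. by rewrite -ler0c -cabsE. Qed.

Lemma cabsM z w : cabs (z * w) = cabs z * cabs w.
Proof. by apply: complexI; rewrite rmorphM /= -!cabsE normrM. Qed.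

Lemma cabsD z w : cabs (z + w) <= cabs z + cabs w.
Proof. by rewrite -lecR rmorphD /= -!cabsE ler_normD. Qed.

Lemma cabsN z : cabs (- z) = cabs z.
Proof. by rewrite /cabs normrN. Qed.

Lemma cabsB z w : cabs (z - w) = cabs (w - z).
Proof. by rewrite /cabs distrC. Qed.

Lemma cabs_conj z : cabs (Num.conj z) = cabs z.
Proof. by rewrite /cabs norm_conjC. Qed.

Lemma cabs_real t : cabs t%:C%C = `|t|.
Proof. by rewrite /cabs normc_def /= expr0n /= addr0 sqrtr_sqr. Qed.

Lemma cabs0 : cabs 0 = 0.
Proof. by rewrite /cabs normr0. Qed.

Lemma cabs0_eq0 z : cabs z = 0 -> z = 0.
Proof. by move=> z0; apply/eqP; rewrite -normr_eq0 cabsE z0. Qed.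

Lemma cabs1 : cabs 1 = 1.
Proof. by rewrite /cabs normr1. Qed.

Lemma ler_normRe z : `|Re z| <= cabs z.
Proof. by rewrite -lecR -cabsE normc_ge_Re. Qed.

Lemma ler_Re_cabs z : Re z <= cabs z.
Proof. exact: le_trans (ler_norm _) (ler_normRe z). Qed.

Lemma sqr_cabs z : cabs z ^+ 2 = Re z ^+ 2 + Im z ^+ 2.
Proof. by apply: complexI; rewrite rmorphXn /= -cabsE -add_Re2_Im2. Qed.

Lemma mul_conj_cabs z : z * Num.conj z = (cabs z ^+ 2)%:C%C.
Proof. by rewrite rmorphXn /= -cabsE -normCK. Qed.

Lemma cabs_le_ReIm z : cabs z <= `|Re z| + `|Im z|.
Proof.
rewrite -(@ler_pXn2r _ 2) ?nnegrE ?addr_ge0 ?cabs_ge0 // sqr_cabs sqrrD.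
rewrite !real_normK ?num_real // addrAC lerDl.
by rewrite mulrn_wge0 // mulr_ge0.
Qed.

Lemma ler_normIm z : `|Im z| <= cabs z.
Proof.
rewrite -(@ler_pXn2r _ 2) ?nnegrE ?cabs_ge0 // sqr_cabs real_normK ?num_real //.
by rewrite lerDr sqr_ge0.
Qed.

Lemma ReB z w : Re (z - w) = Re z - Re w. Proof. by case: z; case: w. Qed.
Lemma ReD z w : Re (z + w) = Re z + Re w. Proof. by case: z; case: w. Qed.
Lemma ImB z w : Im (z - w) = Im z - Im w. Proof. by case: z; case: w. Qed.
Lemma ImD z w : Im (z + w) = Im z + Im w. Proof. by case: z; case: w. Qed.
Lemma ReZ t z : Re (t%:C%C * z) = t * Re z.
Proof. by case: z => a b /=; rewrite mul0r subr0. Qed.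
Lemma Re_conjC z : Re (Num.conj z) = Re z. Proof. by case: z. Qed.
Lemma conj_real t : Num.conj t%:C%C = t%:C%C.
Proof. exact: conjc_real. Qed.
Lemma Re_sum (I : finType) (F : I -> R[i]) :
  Re (\sum_i F i) = \sum_i Re (F i).
Proof. exact: (big_morph _ ReD (erefl : Re (0 : R[i]) = 0)). Qed.

Lemma ImZ t z : Im (t%:C%C * z) = t * Im z.
Proof. by case: z => a b /=; rewrite mul0r addr0. Qed.
Lemma Im_sum (I : finType) (F : I -> R[i]) :
  Im (\sum_i F i) = \sum_i Im (F i).
Proof. exact: (big_morph _ ImD (erefl : Im (0 : R[i]) = 0)). Qed.

Lemma ge0_RRe z : 0 <= z -> z = (Re z)%:C%C.
Proof. by move=> z0; rewrite RRe_real // ger0_real. Qed.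

Lemma ge0_Re z : 0 <= z -> 0 <= Re z.
Proof. by rewrite lecE => /andP[]. Qed.

Lemma le_eps (a b K : R) : (forall e : R, 0 < e -> a <= b + K * e) -> a <= b.
Proof.
move=> h; apply/ler_addgt0Pr => e e0.
have K0 : 0 < `|K| + 1 by rewrite ltr_pwDr.
apply: (le_trans (h (e / (`|K| + 1)) _)); first exact: divr_gt0.
rewrite lerD2l mulrA ler_pdivrMr // mulrC ler_wpM2l ?(ltW e0) //.
by rewrite (le_trans (ler_norm _)) // lerDl.
Qed.

Lemma cabs_le_eps0 z K : (forall e : R, 0 < e -> cabs z <= K * e) -> z = 0.
Proof.
move=> h; apply: cabs0_eq0; apply/eqP; rewrite eq_le cabs_ge0 andbT.
by apply: (@le_eps _ _ K) => e e0; rewrite add0r h.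
Qed.

End ComplexModulus.

Section SequentialLimits.
Variable R : realType.

Lemma inv_small (e : R) : 0 < e -> exists N, forall n, (N <= n)%N -> n.+1%:R^-1 < e.
Proof.
move=> e0; exists (Num.truncn e^-1) => n Nn.
rewrite -[ltRHS]invrK ltf_pV2 ?posrE ?invr_gt0 ?ltr0n //.
rewrite (lt_le_trans (truncnS_gt _)) // ler_nat //.
Qed.

(** The rate [1 / (n + 1)] in the hypothesis survives in the conclusion, so that
    estimates that hold along the sequence pass to the limit quantitatively. *)
Lemma real_limit (u : nat -> R) (K : R) : 0 <= K ->
  (forall m n, `|u m - u n| <= K * (m.+1%:R^-1 + n.+1%:R^-1)) ->
  exists l, forall n, `|u n - l| <= K * n.+1%:R^-1.
Proof.
move=> K0 cu.
have uC : cvgn u.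
  apply/cauchy_cvgP/cauchy_exP => e e0.
  have K1 : 0 < 2 * (K + 1) by rewrite mulr_gt0 // ltr_wpDl.
  have [N hN] := inv_small (divr_gt0 e0 K1).
  exists (u N); exists N => // n Nn; rewrite /ball /=.
  apply: le_lt_trans (cu _ _) _.
  have := hN _ Nn; have := hN _ (leqnn N); rewrite !ltr_pdivlMr // => h1 h2.
  have m0 : 0 <= N.+1%:R^-1 :> R by rewrite invr_ge0.
  have n0 : 0 <= n.+1%:R^-1 :> R by rewrite invr_ge0.
  have Km0 : 0 <= K * N.+1%:R^-1 by rewrite mulr_ge0.
  have Kn0 : 0 <= K * n.+1%:R^-1 by rewrite mulr_ge0.
  have aux (a b c : R) : 0 <= a -> 0 <= b -> 0 <= K * a -> 0 <= K * b ->
      a * (2 * (K + 1)) < c -> b * (2 * (K + 1)) < c -> K * (b + a) < c.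
    by lra.
  by apply: aux.
exists (limn u) => n; apply: (@le_eps _ _ _ (K + 1)) => e e0.
have [N hN] := inv_small e0.
have : \forall m \near \oo, `|u m - limn u| <= e.
  have /cvgrPdist_le/(_ _ e0) := uC.
  by apply: filterS => m; rewrite distrC.
move=> [M _ hM].
have h1 := hM (maxn M N) (leq_maxl _ _).
have h2 := cu n (maxn M N).
have h3 := ler_wpM2l K0 (ltW (hN _ (leq_maxr M N))).
have h4 := ler_distD (u (maxn M N)) (u n) (limn u).
apply: (le_trans h4); apply: (le_trans (lerD h2 h1)).
have -> : K * n.+1%:R^-1 + (K + 1) * e = K * n.+1%:R^-1 + K * e + e by ring.
by rewrite mulrDr lerD2r lerD2l.
Qed.

Lemma complex_limit (u : nat -> R[i]) (K : R) : 0 <= K ->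
  (forall m n, cabs (u m - u n) <= K * (m.+1%:R^-1 + n.+1%:R^-1)) ->
  exists l, forall n, cabs (u n - l) <= 2 * K * n.+1%:R^-1.
Proof.
move=> K0 cu.
have [a ha] := @real_limit (fun n => Re (u n)) K K0 (fun m n =>
  le_trans (eq_ind _ (fun x => `|x| <= _) (ler_normRe _) _ (ReB _ _)) (cu m n)).
have [b hb] := @real_limit (fun n => Im (u n)) K K0 (fun m n =>
  le_trans (eq_ind _ (fun x => `|x| <= _) (ler_normIm _) _ (ImB _ _)) (cu m n)).
exists (Complex a b) => n; apply: le_trans (cabs_le_ReIm _) _.
by rewrite ReB ImB -mulrA mulr_natl mulr2n lerD.
Qed.

End SequentialLimits.

(** * Positive semidefinite sesquilinear forms *)

Record semi_ip (R : realType) (X : lmodType R[i]) := SemiIp {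
  ip :> X -> X -> R[i];
  ip_linear : forall k x y z, ip (k *: x + y) z = k * ip x z + ip y z;
  ip_herm : forall x y, ip y x = Num.conj (ip x y);
  ip_ge0 : forall x, 0 <= ip x x
}.

Section SemiInnerProduct.
Variables (R : realType) (X : lmodType R[i]) (f : semi_ip X).
Implicit Types x y z : X.

Lemma ipDl x y z : f (x + y) z = f x z + f y z.
Proof. by rewrite -[x]scale1r ip_linear mul1r scale1r. Qed.

Lemma ip0l z : f 0 z = 0.
Proof. by apply: (addrI (f 0 z)); rewrite -ipDl !addr0. Qed.

Lemma ipZl k x z : f (k *: x) z = k * f x z.
Proof. by have := ip_linear f k x 0 z; rewrite !addr0 ip0l addr0. Qed.

Lemma ipNl x z : f (- x) z = - f x z.
Proof. by rewrite -scaleN1r ipZl mulN1r. Qed.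

Lemma ipBl x y z : f (x - y) z = f x z - f y z.
Proof. by rewrite ipDl ipNl. Qed.

Lemma ipDr x y z : f x (y + z) = f x y + f x z.
Proof. by rewrite !(ip_herm f _ x) ipDl rmorphD. Qed.

Lemma ipZr k x z : f x (k *: z) = Num.conj k * f x z.
Proof. by rewrite !(ip_herm f _ x) ipZl rmorphM. Qed.

Lemma ipNr x z : f x (- z) = - f x z.
Proof. by rewrite !(ip_herm f _ x) ipNl rmorphN. Qed.

Lemma ipBr x y z : f x (y - z) = f x y - f x z.
Proof. by rewrite ipDr ipNr. Qed.

Lemma ip0r x : f x 0 = 0.
Proof. by rewrite (ip_herm f) ip0l rmorph0. Qed.

Lemma Re_ip_ge0 x : 0 <= Re (f x x).
Proof. exact/ge0_Re/ip_ge0. Qed.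

(** The form is evaluated at [s x - t c y], with [s] and [t] real and
    [c = f x y].  When [y] is isotropic, and possibly [x] too, the choice
    [t = Re (f x x) + 1] still forces [c] to vanish. *)
Lemma ip_cauchy_schwarz x y : cabs (f x y) ^+ 2 <= Re (f x x) * Re (f y y).
Proof.
set c := f x y; set a := Re (f x x); set b := Re (f y y).
have a0 : 0 <= a by exact: Re_ip_ge0.
have b0 : 0 <= b by exact: Re_ip_ge0.
have key (s t : R) : 0 <= s ^+ 2 * a - 2 * s * t * cabs c ^+ 2
                      + t ^+ 2 * cabs c ^+ 2 * b.
  have := Re_ip_ge0 (s%:C%C *: x - (t%:C%C * c) *: y).
  rewrite ipBl !ipBr !ipZl !ipZr -/c (ip_herm f x y) -/c.
  rewrite [f x x](ge0_RRe (ip_ge0 f x)) [f y y](ge0_RRe (ip_ge0 f y)) -/a -/b.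
  rewrite !rmorphM /= !conj_real.
  rewrite (_ : _ - _ - _ = (s ^+ 2 * a)%:C%C
    - (2 * s * t)%:C%C * (c * Num.conj c)
    + (t ^+ 2 * b)%:C%C * (c * Num.conj c)); last first.
    by ring.
  rewrite mul_conj_cabs ReD ReB !ReZ /=.
  by congr (_ <= _); ring.
have := key b 1; have := key (cabs c ^+ 2) (a + 1).
have := sqr_ge0 (cabs c); set d := cabs c ^+ 2 => d0 h2 h1.
have [bz|bp] := eqVneq b 0; last first.
  have : 0 <= b * (b * a - d) by move: h1; congr (_ <= _); ring.
  by rewrite pmulr_rge0 ?lt_def ?bp // subr_ge0 mulrC.
rewrite bz mulr0; apply: contraTT h2; rewrite -ltNge => dp; rewrite -ltNge bz.
have a2 : 0 < a + 2 by lra.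
have := mulr_gt0 (mulr_gt0 dp dp) a2; lra.
Qed.

Definition seminorm x : R := Num.sqrt (Re (f x x)).

Lemma seminorm_ge0 x : 0 <= seminorm x. Proof. exact: sqrtr_ge0. Qed.

Lemma sqr_seminorm x : seminorm x ^+ 2 = Re (f x x).
Proof. by rewrite sqr_sqrtr // Re_ip_ge0. Qed.

Lemma ip_seminorm x : f x x = (seminorm x ^+ 2)%:C%C.
Proof. by rewrite sqr_seminorm -ge0_RRe // ip_ge0. Qed.

Lemma cabs_ip x y : cabs (f x y) <= seminorm x * seminorm y.
Proof.
rewrite -(@ler_pXn2r _ 2) ?nnegrE ?mulr_ge0 ?seminorm_ge0 ?cabs_ge0 //.
by rewrite exprMn !sqr_seminorm ip_cauchy_schwarz.
Qed.

Lemma seminormD x y : seminorm (x + y) <= seminorm x + seminorm y.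
Proof.
rewrite -(@ler_pXn2r _ 2) ?nnegrE ?addr_ge0 ?seminorm_ge0 //.
rewrite sqr_seminorm sqrrD !sqr_seminorm ipDl !ipDr !ReD (ip_herm f x y) Re_conjC.
by have := le_trans (ler_Re_cabs _) (cabs_ip x y); lra.
Qed.

Lemma seminormZ k x : seminorm (k *: x) = cabs k * seminorm x.
Proof.
rewrite /seminorm ipZl ipZr mulrA mul_conj_cabs ReZ.
by rewrite sqrtrM ?sqr_ge0 // sqrtr_sqr ger0_norm ?cabs_ge0.
Qed.

Lemma seminormN x : seminorm (- x) = seminorm x.
Proof. by rewrite -scaleN1r seminormZ cabsN cabs1 mul1r. Qed.

Definition antilinear (u : X -> R[i]) :=
  forall k x y, u (k *: x + y) = Num.conj k * u x + u y.

Definition fbound (u : X -> R[i]) (M : R) :=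
  forall y, cabs (u y) <= M * seminorm y.

(** If [x] minimises [J x = |x|^2 - 2 Re (u x)] up to [e^2], then comparing [J]
    at [x] and at [x + t c y], with [c = u y - <x, y>], bounds [c] by [e |y|].  This
    is Riesz's representation theorem up to [e], prior to any completion. *)
Lemma ip_dense (u : X -> R[i]) (M e : R) : antilinear u -> fbound u M -> 0 < e ->
  exists x, fbound (fun y => u y - f x y) e.
Proof.
move=> ul ub e0.
have u0 : u 0 = 0.
  by have := ul (-1) 0 0; rewrite scaler0 addr0 rmorphN rmorph1 mulN1r addNr.
have uZ k x : u (k *: x) = Num.conj k * u x.
  by have := ul k x 0; rewrite !addr0 u0 addr0.
have uD x y : u (x + y) = u x + u y.
  by have := ul 1 x y; rewrite scale1r rmorph1 mul1r.
pose J x := seminorm x ^+ 2 - 2 * Re (u x).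
pose S := [set J x | x in [set: X]].
have Slb : has_inf S.
  split; first by exists (J 0); exists 0.
  exists (- M ^+ 2) => _ [x _ <-]; rewrite /J.
  have := le_trans (ler_Re_cabs _) (ub x); have := sqr_ge0 (seminorm x - M).
  rewrite sqrrB; lra.
have [_ [x _ <-] Jx] : exists2 t, S t & t < inf S + e ^+ 2.
  by apply: inf_adherent => //; rewrite exprn_gt0.
have Jmin y : inf S <= J y by apply: ge_inf; [exact: Slb.2 | exists y].
exists x => y; set c := u y - f x y.
have key (t : R) :
    2 * t * cabs c ^+ 2 <= t ^+ 2 * cabs c ^+ 2 * seminorm y ^+ 2 + e ^+ 2.
  have := Jmin (x + (t%:C%C * c) *: y); move: Jx; rewrite /J.
  rewrite uD uZ !sqr_seminorm ipDl !ipDr !ipZl !ipZr (ip_herm f x y).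
  rewrite [f y y](ge0_RRe (ip_ge0 f y)) !rmorphM /= conj_real.
  have -> : u y = c + f x y by rewrite /c subrK.
  have e1 : Re (t%:C%C * Num.conj c * (c + f x y)) =
     t * cabs c ^+ 2 + t * Re (Num.conj c * f x y).
    rewrite -mulrA ReZ mulrDr ReD [Num.conj c * c]mulrC mul_conj_cabs /=.
    by rewrite mulrDr.
  have e2 : Re (t%:C%C * Num.conj c * f x y) = t * Re (Num.conj c * f x y).
    by rewrite -mulrA ReZ.
  have e3 : Re (t%:C%C * c * Num.conj (f x y)) = t * Re (Num.conj c * f x y).
    by rewrite -mulrA ReZ -[in LHS](Re_conjC) rmorphM /= conjCK.
  have e4 : Re (t%:C%C * c * (t%:C%C * Num.conj c * (Re (f y y))%:C%C)) =
     t ^+ 2 * cabs c ^+ 2 * Re (f y y).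
    rewrite (_ : _ * _ = (t ^+ 2)%:C%C * ((Re (f y y))%:C%C * (c * Num.conj c))).
      by rewrite ReZ ReZ mul_conj_cabs /=; ring.
    by ring.
  rewrite !ReD e1 e2 e3 e4; lra.
have c0 := cabs_ge0 c; have s0 := seminorm_ge0 y.
rewrite leNgt; apply/negP => lt.
have cp : 0 < cabs c by apply: le_lt_trans lt; apply: mulr_ge0 => //; exact: ltW.
have [s00|sp] := eqVneq (seminorm y) 0.
  have := key ((e ^+ 2 + 1) / cabs c ^+ 2).
  rewrite s00 expr0n /= mulr0 add0r -mulrA divfK ?expf_neq0 ?gt_eqF //.
  by have := sqr_ge0 e; lra.
have sp' : 0 < seminorm y by rewrite lt_def sp.
have := key (e / (cabs c * seminorm y)).
rewrite !expr_div_n !exprMn.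
rewrite (_ : e ^+ 2 / _ * _ * _ = e ^+ 2); last first.
  by field; rewrite !gt_eqF.
rewrite (_ : 2 * _ * _ = 2 * e * (cabs c / seminorm y)); last first.
  by field; rewrite !gt_eqF.
have : e < cabs c / seminorm y by rewrite ltr_pdivlMr.
nra.
Qed.

End SemiInnerProduct.

(** * The Hilbert space completing a positive semidefinite form *)

Section Completion.
Variables (R : realType) (X : lmodType R[i]) (f : semi_ip X).
Implicit Types (x y z : X).

Definition bounded_antilinear : {pred X -> R[i]} :=
  fun u => `[< antilinear u /\ exists2 M, 0 <= M & fbound f u M >].

Fact bounded_antilinear_submod : GRing.submod_closed bounded_antilinear.
Proof.
split.
  apply/asboolP; split; first by move=> k x y; rewrite /= mulr0 addr0.
  by exists 0 => // y; rewrite mul0r cabs0.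
move=> k u v /asboolP[ul [M M0 uM]] /asboolP[vl [N N0 vN]]; apply/asboolP; split.
  move=> l x y; rewrite !fctE ul vl /GRing.scale /=; ring.
exists (cabs k * M + N); first by rewrite addr_ge0 // mulr_ge0 // cabs_ge0.
move=> y; rewrite !fctE; apply: le_trans (cabsD _ _) _.
rewrite mulrDl lerD // cabsM -mulrA ler_wpM2l ?cabs_ge0 //; exact: uM.
Qed.

(** The completion of [X] is realised inside its antidual: by [ip_dense] it is
    the whole space of bounded antilinear functionals. *)
Record completion := Completion {
  cval : X -> R[i];
  cvalP : cval \in bounded_antilinear
}.

HB.instance Definition _ := [isSub for cval].
HB.instance Definition _ := [Choice of completion by <:].
HB.instance Definition _ := GRing.isSubmodClosed.Build R[i] (X -> R[i])
  bounded_antilinear (GRing.submod_closed_semi bounded_antilinear_submod).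
HB.instance Definition _ := [SubChoice_isSubLmodule of completion by <:].

Implicit Types u v w : completion.

Lemma cvalD u v x : cval (u + v) x = cval u x + cval v x. Proof. by []. Qed.
Lemma cvalZ k u x : cval (k *: u) x = k * cval u x. Proof. by []. Qed.
Lemma cvalN u x : cval (- u) x = - cval u x. Proof. by []. Qed.
Lemma cval0 x : cval 0 x = 0. Proof. by []. Qed.
Lemma completionP u v : cval u =1 cval v -> u = v.
Proof. by move=> uv; apply: val_inj; apply/funext. Qed.

End Completion.

Section CompletionInnerProduct.
Variables (R : realType) (X : lmodType R[i]) (f : semi_ip X).
Implicit Types (x y z : X) (u v w : completion f).

Lemma cval_antilinear u : antilinear (cval u).
Proof. by have /asboolP[] := cvalP u. Qed.

Lemma cval_bound u : exists2 M, 0 <= M & fbound f (cval u) M.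
Proof. by have /asboolP[] := cvalP u. Qed.

Lemma cval_linD u x y : cval u (x + y) = cval u x + cval u y.
Proof. by have := cval_antilinear u 1 x y; rewrite scale1r rmorph1 mul1r. Qed.

Lemma cval_lin0 u : cval u 0 = 0.
Proof. by apply: (addrI (cval u 0)); rewrite -cval_linD !addr0. Qed.

Lemma cval_linZ u k x : cval u (k *: x) = Num.conj k * cval u x.
Proof. by have := cval_antilinear u k x 0; rewrite !addr0 cval_lin0 addr0. Qed.

Lemma cval_linB u x y : cval u (x - y) = cval u x - cval u y.
Proof. by rewrite cval_linD -scaleN1r cval_linZ rmorphN rmorph1 mulN1r. Qed.

Fact embed_subproof x : f x \in bounded_antilinear f.
Proof.
apply/asboolP; split; first by move=> k y z; rewrite ipDr ipZr.
by exists (seminorm f x); [exact: seminorm_ge0 | move=> y; exact: cabs_ip].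
Qed.

Definition embed x : completion f := Completion (embed_subproof x).

Lemma embedE x y : cval (embed x) y = f x y. Proof. by []. Qed.

(** The distance of [u] to the image of [x], measured in the antidual: the inner
    product of the completion is constructed from it. *)
Definition approx u x (e : R) := fbound f (fun y => cval u y - f x y) e.

Lemma approx_ex u (e : R) : 0 < e -> exists x, approx u x e.
Proof.
have [M _ uM] := cval_bound u.
exact: (ip_dense (cval_antilinear u) uM).
Qed.

Lemma approx_embed x : approx (embed x) x 0.
Proof. by move=> y; rewrite embedE subrr cabs0 mul0r. Qed.

Lemma seminorm_le x (e : R) : 0 <= e -> fbound f (f x) e -> seminorm f x <= e.
Proof.
move=> e0 /(_ x); rewrite ip_seminorm cabs_real ger0_norm ?sqr_ge0 // expr2.
have [->|s0] := eqVneq (seminorm f x) 0; first by rewrite mulr0.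
by rewrite ler_pM2r // lt_def s0 seminorm_ge0.
Qed.

Lemma approx_sub u x y (d e : R) : 0 <= d -> 0 <= e ->
  approx u x d -> approx u y e -> seminorm f (x - y) <= d + e.
Proof.
move=> d0 e0 ux uy; apply: seminorm_le; first exact: addr_ge0.
move=> z; rewrite ipBl.
rewrite (_ : _ - _ = (cval u z - f y z) - (cval u z - f x z)); last by ring.
by rewrite (le_trans (cabsD _ _)) // cabsN addrC mulrDl lerD.
Qed.

Lemma approx_seminorm u x (M e : R) : 0 <= M -> 0 <= e -> fbound f (cval u) M ->
  approx u x e -> seminorm f x <= M + e.
Proof.
move=> M0 e0 uM ux; apply: seminorm_le; first exact: addr_ge0.
move=> y; rewrite (_ : f x y = cval u y - (cval u y - f x y)); last by ring.
by rewrite (le_trans (cabsD _ _)) // cabsN mulrDl lerD.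
Qed.

(** The value [<u, v>] is pinned down by its approximations [<x, v>]. *)
Definition dot_spec u v (z : R[i]) := forall x (d M : R), 0 <= d -> 0 <= M ->
  fbound f (cval v) M -> approx u x d -> cabs (z - Num.conj (cval v x)) <= M * d.

(** Approximations of [u] at rate [1 / (n + 1)] form a Cauchy sequence for the
    seminorm, along which [v] converges. *)
Lemma dot_spec_ex u v : exists l, dot_spec u v l.
Proof.
have e_gt0 n : 0 < n.+1%:R^-1 :> R by rewrite invr_gt0.
have /choice[x ux] : forall n, exists x, approx u x n.+1%:R^-1.
  by move=> n; exact: approx_ex.
have [N N0 vN] := cval_bound v.
have [l hl] : exists l, forall n, cabs (cval v (x n) - l) <= 2 * N * n.+1%:R^-1.
  apply: complex_limit => // m n; rewrite -cval_linB (le_trans (vN _)) //.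
  by rewrite ler_wpM2l //; apply: (approx_sub _ _ (ux m) (ux n)); exact: ltW.
exists (Num.conj l) => y d M d0 M0 vM uy; rewrite -rmorphB cabs_conj.
apply: (@le_eps _ _ _ (2 * N + M)) => e e0.
have [n /(_ n (leqnn n)) /ltW ne] := inv_small e0.
have h1 : cabs (l - cval v (x n)) <= 2 * N * e.
  by rewrite cabsB (le_trans (hl n)) // ler_wpM2l // mulr_ge0.
have h2 : cabs (cval v (x n) - cval v y) <= M * (e + d).
  rewrite -cval_linB (le_trans (vM _)) // ler_wpM2l //.
  by rewrite (le_trans (approx_sub _ _ (ux n) uy)) ?lerD2r // ltW.
rewrite (_ : l - _ = (l - cval v (x n)) + (cval v (x n) - cval v y)); last by ring.
by apply: le_trans (cabsD _ _) _; move: (lerD h1 h2); congr (_ <= _); ring.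
Qed.

Definition cdot u v : R[i] := xget 0 [set l | dot_spec u v l].

Lemma cdotP u v : dot_spec u v (cdot u v).
Proof.
by have [z uvz] := dot_spec_ex u v; rewrite /cdot; case: xgetP => // /(_ z).
Qed.

Lemma cdot_embedl x v : cdot (embed x) v = Num.conj (cval v x).
Proof.
have [M M0 vM] := cval_bound v.
have := cdotP (lexx 0) M0 vM (approx_embed x); rewrite mulr0 => h.
apply/eqP; rewrite -subr_eq0; apply/eqP/cabs0_eq0/eqP.
by rewrite eq_le h cabs_ge0.
Qed.

Lemma cdot_linear k u v w : cdot (k *: u + v) w = k * cdot u w + cdot v w.
Proof.
have [M M0 wM] := cval_bound w.
apply/eqP; rewrite -subr_eq0; apply/eqP.
apply: (@cabs_le_eps0 _ _ (2 * M * (cabs k + 1))) => e e0.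
have [x ux] := approx_ex u e0; have [y vy] := approx_ex v e0.
have kx : approx (k *: u + v) (k *: x + y) (cabs k * e + e).
  move=> z; rewrite cvalD cvalZ ip_linear.
  rewrite (_ : _ - _ = k * (cval u z - f x z) + (cval v z - f y z)); last by ring.
  rewrite (le_trans (cabsD _ _)) // mulrDl lerD // cabsM -mulrA.
  by rewrite ler_wpM2l ?cabs_ge0.
have h0 : 0 <= cabs k * e + e by rewrite addr_ge0 ?mulr_ge0 ?cabs_ge0 // ltW.
have h1 := cdotP h0 M0 wM kx.
have h2 := cdotP (ltW e0) M0 wM ux.
have h3 := cdotP (ltW e0) M0 wM vy.
move: h1; rewrite cval_antilinear rmorphD rmorphM /= conjCK.
set a := cdot _ w; set b := cdot u w in h2 *; set c := cdot v w in h3 *.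
set p := Num.conj (cval w x) in h2 *; set q := Num.conj (cval w y) in h3 * => h1.
rewrite (_ : a - _ = (a - (k * p + q)) - (k * (b - p) + (c - q))); last by ring.
apply: le_trans (cabsD _ _) _; rewrite cabsN.
have h4 := lerD h1 (le_trans (cabsD _ _) (lerD (lexx (cabs (k * (b - p)))) h3)).
apply: le_trans h4 _; rewrite cabsM.
have := ler_wpM2l (cabs_ge0 k) h2; lra.
Qed.

(** Both sides are approximated by [<x, y>], with [x] close to [u] and [y] close
    to [v]. *)
Lemma cdot_herm u v : cdot v u = Num.conj (cdot u v).
Proof.
have [M M0 uM] := cval_bound u; have [N N0 vN] := cval_bound v.
apply/eqP; rewrite -subr_eq0; apply/eqP.
apply: (@cabs_le_eps0 _ _ (2 * (M + N + 1))) => e' e0'.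
pose e := Num.min e' 1.
have e0 : 0 < e by rewrite lt_min e0' ltr01.
have e1 : e <= 1 by rewrite ge_min lexx orbT.
have ee : e <= e' by rewrite ge_min lexx.
have [x ux] := approx_ex u e0; have [y vy] := approx_ex v e0.
have h1 := cdotP (ltW e0) M0 uM vy.
have h2 := cdotP (ltW e0) N0 vN ux.
have sx := approx_seminorm M0 (ltW e0) uM ux.
have sy := approx_seminorm N0 (ltW e0) vN vy.
have h3 : cabs (cval v x - f y x) <= e * (M + e).
  by apply: le_trans (vy x) _; rewrite ler_wpM2l // ltW.
have h4 : cabs (cval u y - f x y) <= e * (N + e).
  by apply: le_trans (ux y) _; rewrite ler_wpM2l // ltW.
rewrite -cabs_conj rmorphB /= conjCK in h2.
rewrite -cabs_conj rmorphB /= -(ip_herm f x y) in h4.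
rewrite (_ : _ - _ = (cdot v u - Num.conj (cval u y))
   + (Num.conj (cval u y) - f y x) + (f y x - cval v x)
   + (cval v x - Num.conj (cdot u v))); last by ring.
apply: le_trans (cabsD _ _) _; rewrite cabsB in h2.
apply: le_trans (lerD (le_trans (cabsD _ _) (lerD (cabsD _ _) (lexx _))) h2) _.
rewrite [cabs (f y x - _)]cabsB.
apply: le_trans (lerD (lerD (lerD h1 h4) h3) (lexx _)) _.
have : (M + N + 1) * e <= (M + N + 1) * e' by rewrite ler_wpM2l // !addr_ge0.
have : e * e <= e by rewrite ler_piMr // ltW.
lra.
Qed.

Lemma cdot_embedr u x : cdot u (embed x) = cval u x.
Proof. by rewrite cdot_herm cdot_embedl conjCK. Qed.

Lemma cdot_approx u (e : R) : 0 < e ->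
  exists x, approx u x e /\ cabs (cdot u u - f x x) <= e.
Proof.
move=> e0'; have [M M0 uM] := cval_bound u.
have den : 0 < 2 * M + 1 by rewrite ltr_wpDl ?mulr_ge0.
pose d := Num.min (Num.min e 1) (e / (2 * M + 1) / 2).
have dp : 0 < d by rewrite !lt_min e0' ltr01 !divr_gt0.
have [x ux] := approx_ex u dp; exists x.
have de : d <= e by rewrite !ge_min lexx.
have d1 : d <= 1 by rewrite !ge_min lexx orbT.
have dM : d * 2 * (2 * M + 1) <= e.
  by rewrite -!ler_pdivlMr // ge_min lexx orbT.
split.
  by move=> y; rewrite (le_trans (ux y)) // ler_wpM2r // seminorm_ge0.
have h1 := cdotP (ltW dp) M0 uM ux.
have sx := approx_seminorm M0 (ltW dp) uM ux.
have h2 : cabs (cval u x - f x x) <= d * (M + d).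
  by apply: le_trans (ux x) _; rewrite ler_wpM2l // ltW.
rewrite -cabs_conj rmorphB /= -(ip_herm f x x) in h2.
rewrite (_ : _ - _ = (cdot u u - Num.conj (cval u x)) +
  (Num.conj (cval u x) - f x x)); last by ring.
apply: le_trans (cabsD _ _) _; apply: le_trans (lerD h1 h2) _.
have : d * d <= d by rewrite ler_piMr // ltW.
lra.
Qed.

Lemma cdot_ge0 u : 0 <= cdot u u.
Proof.
have im0 : Im (cdot u u) = 0.
  by have := cdot_herm u u; case: (cdot u u) => a b [] /=; lra.
rewrite lecE /= im0 eqxx /=; apply: (@le_eps _ _ _ 1) => e e0.
have [x [_ ux]] := cdot_approx u e0; rewrite mul1r.
have := Re_ip_ge0 f x; have := le_trans (ler_Re_cabs _) ux.
have := le_trans (ler_normRe _) ux; rewrite ReB ler_norml => /andP[]; lra.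
Qed.

Definition cdot_ip : semi_ip (completion f) :=
  SemiIp cdot_linear cdot_herm cdot_ge0.

Definition cnrm u : R := seminorm cdot_ip u.

Lemma cnrm_embed x : cnrm (embed x) = seminorm f x.
Proof. by rewrite /cnrm /seminorm /= cdot_embedr embedE. Qed.

Lemma cval_le u x : cabs (cval u x) <= cnrm u * seminorm f x.
Proof. by rewrite -cdot_embedr -cnrm_embed; exact: (cabs_ip cdot_ip). Qed.

Lemma cnrm_le u (M : R) : 0 <= M -> fbound f (cval u) M -> cnrm u <= M.
Proof.
move=> M0 uM.
suff : cnrm u ^+ 2 <= M ^+ 2.
  by rewrite ler_pXn2r ?nnegrE // seminorm_ge0.
apply: (@le_eps _ _ _ (2 * M + 2)) => e' e0'.
pose e := Num.min e' 1.
have e0 : 0 < e by rewrite lt_min e0' ltr01.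
have e1 : e <= 1 by rewrite ge_min lexx orbT.
have ee : e <= e' by rewrite ge_min lexx.
have [x [ux h]] := cdot_approx u e0.
have sx := approx_seminorm M0 (ltW e0) uM ux.
rewrite /cnrm sqr_seminorm /=.
have := le_trans (ler_Re_cabs _) h; rewrite ReB ip_seminorm /=.
have : seminorm f x ^+ 2 <= (M + e) ^+ 2.
  by rewrite ler_pXn2r ?nnegrE ?seminorm_ge0 // addr_ge0 // ltW.
rewrite sqrrD.
have : e ^+ 2 <= e by rewrite expr2 ler_piMr // ltW.
have : (2 * M + 2) * e <= (2 * M + 2) * e' by rewrite ler_wpM2l // addr_ge0 // mulr_ge0.
lra.
Qed.

Lemma cnrm_eq0 u : cnrm u = 0 -> u = 0.
Proof.
move=> u0; apply: completionP => x; rewrite cval0; apply: cabs0_eq0.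
by apply/eqP; rewrite eq_le cabs_ge0 andbT (le_trans (cval_le u x)) // u0 mul0r.
Qed.

End CompletionInnerProduct.

Section CompletionHilbert.
Variables (R : realType) (X : lmodType R[i]) (f : semi_ip X).
Implicit Types (x y z : X) (u v w : completion f).

Definition cnorm_C u : R[i] := (cnrm u)%:C%C.

Fact cnorm_CD u v : cnorm_C (u + v) <= cnorm_C u + cnorm_C v.
Proof. by rewrite /cnorm_C -rmorphD /= lecR; exact: seminormD. Qed.

Fact cnorm_CZ k u : cnorm_C (k *: u) = `|k| * cnorm_C u.
Proof. by rewrite /cnorm_C cabsE -rmorphM /= /cnrm seminormZ. Qed.

Fact cnorm_C0 u : cnorm_C u = 0 -> u = 0.
Proof. by case=> /cnrm_eq0. Qed.

HB.instance Definition _ := Lmodule_isNormed.Build R[i] (completion f)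
  cnorm_CD cnorm_CZ cnorm_C0.

Lemma normE u : `|u| = (cnrm u)%:C%C. Proof. by []. Qed.

Lemma ballE u v (e : R) : ball u e%:C%C v -> cnrm (u - v) < e.
Proof. by rewrite -ball_normE /ball_ /= normE ltcR. Qed.

(** A Cauchy filter yields a sequence [c] that is Cauchy at rate [1 / (n + 1)];
    its pointwise limit is again a bounded antilinear functional. *)
Fact completion_complete (F : set_system (completion f)) :
  ProperFilter F -> cauchy F -> cvg F.
Proof.
move=> FF /cauchyP Fc.
have e_gt0 n : 0 < n.+1%:R^-1 :> R by rewrite invr_gt0.
have /choice[c Fc'] : forall n, exists u, F (ball u (n.+1%:R^-1 : R)%:C%C).
  by move=> n; apply: Fc; rewrite ltcR.
have cc m n : cnrm (c m - c n) <= 1 * (m.+1%:R^-1 + n.+1%:R^-1).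
  have [u [um un]] := filter_ex (filterI (Fc' m) (Fc' n)).
  have {}um := ballE um; have {}un := ballE un.
  rewrite mul1r (_ : _ - _ = (c m - u) - (c n - u)); last by rewrite opprB addrA subrK.
  apply: le_trans (seminormD _ _ _) _; rewrite seminormN.
  by apply: lerD; apply: ltW.
have /choice[g hg] : forall y, exists l, forall n,
    cabs (cval (c n) y - l) <= 2 * seminorm f y * n.+1%:R^-1.
  move=> y; apply: complex_limit; first exact: seminorm_ge0.
  move=> m n; rewrite -cvalN -cvalD mulrC (le_trans (cval_le _ _)) //.
  by rewrite ler_wpM2r ?seminorm_ge0 // (le_trans (cc m n)) // mul1r.
have gl : antilinear g.
  move=> k x y; apply/eqP; rewrite -subr_eq0; apply/eqP.
  apply: (@cabs_le_eps0 _ _ (2 * (seminorm f (k *: x + y) +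
    cabs k * seminorm f x + seminorm f y))) => e e0.
  have [n /(_ n (leqnn n)) /ltW ne] := inv_small e0.
  have h1 := hg (k *: x + y) n; have h2 := hg x n; have h3 := hg y n.
  rewrite cval_antilinear in h1.
  rewrite (_ : _ - _ = (Num.conj k * (cval (c n) x - g x) + (cval (c n) y - g y))
     - (Num.conj k * cval (c n) x + cval (c n) y - g (k *: x + y))); last by ring.
  apply: le_trans (cabsD _ _) _; rewrite cabsN.
  apply: le_trans (lerD (le_trans (cabsD _ _) (lerD (lexx _) h3)) h1) _.
  rewrite cabsM cabs_conj.
  have := ler_wpM2l (cabs_ge0 k) h2.
  set s := seminorm f (_ + _); set t := seminorm f x; set r := seminorm f y.
  have K0 : 0 <= 2 * (s + cabs k * t + r).
    by rewrite mulr_ge0 // !addr_ge0 ?mulr_ge0 ?seminorm_ge0 ?cabs_ge0.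
  move=> h4; apply: le_trans (ler_wpM2l K0 ne).
  apply: le_trans (lerD (lerD h4 (lexx _)) (lexx _)) _.
  by rewrite le_eqVlt; apply/orP; left; apply/eqP; ring.
have [M M0 cM] := cval_bound (c 0).
have gb : g \in bounded_antilinear f.
  apply/asboolP; split => //; exists (M + 2); first exact: addr_ge0.
  move=> y; rewrite (_ : g y = cval (c 0) y - (cval (c 0) y - g y)); last by ring.
  apply: le_trans (cabsD _ _) _; rewrite cabsN mulrDl lerD //.
  by rewrite (le_trans (hg y 0)) // invr1 mulr1.
pose u : completion f := Completion gb.
have cu n : cnrm (u - c n) <= 2 * n.+1%:R^-1.
  apply: cnrm_le; first by rewrite mulr_ge0 // ltW.
  move=> y; rewrite cvalD cvalN cabsB (le_trans (hg y n)) //.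
  by rewrite mulrAC.
apply/cvg_ex; exists u; apply/cvgrPdist_le => e e0.
have eE := ge0_RRe (ltW e0).
have e1 : 0 < Re e / 3 by rewrite divr_gt0 // -ltcR -eE.
have [n /(_ n (leqnn n)) /ltW ne] := inv_small e1.
apply: filterS (Fc' n) => v /ballE/ltW cv.
rewrite normE eE lecR (_ : _ - _ = (u - c n) + (c n - v)); last by rewrite addrA subrK.
apply: le_trans (seminormD _ _ _) _; apply: le_trans (lerD (cu n) cv) _.
by move: ne; move: (n.+1%:R^-1) => d; lra.
Qed.

HB.instance Definition _ := Uniform_isComplete.Build (completion f)
  completion_complete.

Fact cdot_bilinear : bilinear_for
  (GRing.Scale.Law.clone _ _ *%R _)
  (GRing.Scale.Law.clone _ _ (Num.conj \; *%R) _)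
  (@cdot R X f).
Proof.
split=> u; first by move=> k v w; rewrite cdot_linear.
move=> k v w /=.
by have := ipDr (cdot_ip f) u (k *: v) w; rewrite ipZr.
Qed.

HB.instance Definition _ := bilinear_isBilinear.Build R[i] (completion f)
  (completion f) R[i] _ _ (@cdot R X f) cdot_bilinear.

Fact cdot_hermitian u v : cdot u v = (-1) ^+ false * Num.conj (cdot v u).
Proof. by rewrite expr0 mul1r -cdot_herm. Qed.

HB.instance Definition _ := isHermitianSesquilinear.Build R[i] (completion f)
  false Num.conj (@cdot R X f) cdot_hermitian.

Fact cdot_gt0 u : u != 0 -> 0 < cdot u u.
Proof.
move=> u0; rewrite lt_def (cdot_ge0 u) andbT; apply: contra u0 => /eqP uu.
by apply/eqP/cnrm_eq0; rewrite /cnrm /seminorm /= uu sqrtr0.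
Qed.

HB.instance Definition _ := isDotProduct.Build R[i] (completion f)
  (@cdot R X f) cdot_gt0.

Fact cdotE u : (@cdot R X f) u u = `|u| ^+ 2.
Proof. by rewrite normE -rmorphXn /=; exact: (ip_seminorm (cdot_ip f)). Qed.

HB.instance Definition _ := isHilbert.Build R (completion f) cdotE.

End CompletionHilbert.

Lemma linear_mapB (K : nzRingType) (V W : lmodType K) (T : V -> W) u v :
  linear T -> T (u - v) = T u - T v.
Proof. by move=> Tl; rewrite addrC -scaleN1r Tl scaleN1r addrC. Qed.

Lemma linear_mapZ (K : nzRingType) (V W : lmodType K) (T : V -> W) k u :
  linear T -> T (k *: u) = k *: T u.
Proof.
move=> Tl; have T0 : T 0 = 0 by have := linear_mapB 0 0 Tl; rewrite !subrr.
by have := Tl k u 0; rewrite T0 !addr0.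
Qed.

Lemma lipschitz_bounded_op (R : realType) (H : hilbertType R) (T : H -> H) (M : R) :
  linear T -> (forall u, `|T u| <= M%:C%C * `|u|) -> bounded_op T.
Proof.
move=> Tl TM; split=> // u; apply/cvgrPdist_le => e e0.
have eE := ge0_RRe (ltW e0).
have Re0 : 0 < Re e by rewrite -ltcR -eE.
have M0 : 0 < `|M| + 1 by rewrite ltr_wpDl.
have d0 : 0 < (Re e / (`|M| + 1))%:C%C by rewrite ltcR divr_gt0.
near=> v.
have uv : `|u - v| <= (Re e / (`|M| + 1))%:C%C.
  by near: v; apply: (@cvgr_dist_le _ _ _ (nbhs u)).
rewrite -(linear_mapB _ _ Tl) (le_trans (TM _)) //.
apply: (@le_trans _ _ ((`|M| + 1)%:C%C * `|u - v|)).
  by rewrite ler_wpM2r // lecR (le_trans (ler_norm _)) // lerDl.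
rewrite eE -(divfK (lt0r_neq0 M0) (Re e)) rmorphM /= mulrC.
by rewrite ler_wpM2r // lecR ltW.
Unshelve. all: by end_near. Qed.

Section DensityArguments.
Variables (R : realType) (X : lmodType R[i]) (f : semi_ip X).
Implicit Types (x y z : X) (u v w : completion f) (S T : completion f -> completion f).

Lemma cnrm_ge0 u : 0 <= cnrm u. Proof. exact: seminorm_ge0. Qed.

Lemma cdotBl u v w : cdot (u - v) w = cdot u w - cdot v w.
Proof. exact: (ipBl (cdot_ip f)). Qed.

Lemma cdotBr u v w : cdot w (u - v) = cdot w u - cdot w v.
Proof. exact: (ipBr (cdot_ip f)). Qed.

Lemma cdotDr u v w : cdot w (u + v) = cdot w u + cdot w v.
Proof. exact: (ipDr (cdot_ip f)). Qed.

Lemma cdotZl k u v : cdot (k *: u) v = k * cdot u v.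
Proof. exact: (ipZl (cdot_ip f)). Qed.

Lemma cdotZr k u v : cdot u (k *: v) = Num.conj k * cdot u v.
Proof. exact: (ipZr (cdot_ip f)). Qed.

Lemma cabs_cdot u v : cabs (cdot u v) <= cnrm u * cnrm v.
Proof. exact: (cabs_ip (cdot_ip f)). Qed.

Lemma embed_dense u (e : R) : 0 < e -> exists x, cnrm (u - embed f x) <= e.
Proof.
move=> e0; have [x ux] := approx_ex u e0; exists x.
by apply: cnrm_le => [|y]; [exact: ltW | rewrite cvalD cvalN embedE].
Qed.

Definition opbound T M := linear T /\ forall u, cnrm (T u) <= M * cnrm u.

Lemma opbound_bounded_op T (M : R) : opbound T M -> bounded_op T.
Proof.
move=> [Tl TM]; apply: (@lipschitz_bounded_op _ _ _ M) => // u.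
by rewrite !normE -rmorphM /= lecR.
Qed.

(** Symmetry and positivity of an operator pass from [X] to the completion by this
    estimate on the coefficients [<T u, v>]. *)
Lemma cdot_op_approx T (M : R) u v : opbound T M -> exists2 K, 0 <= K &
  forall e x y, 0 < e <= 1 -> cnrm (u - embed f x) <= e ->
    cnrm (v - embed f y) <= e ->
    cabs (cdot (T u) v - cdot (T (embed f x)) (embed f y)) <= K * e.
Proof.
move=> [Tl TM]; have M0 := normr_ge0 M.
exists (`|M| * (cnrm v + cnrm u + 1)).
  by rewrite mulr_ge0 // !addr_ge0 ?cnrm_ge0.
move=> e x y /andP[e0 e1] ux vy.
have TM' w : cnrm (T w) <= `|M| * cnrm w.
  by rewrite (le_trans (TM w)) // ler_wpM2r ?cnrm_ge0 // ler_norm.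
have -> : cdot (T u) v - cdot (T (embed f x)) (embed f y) =
    cdot (T (u - embed f x)) v + cdot (T (embed f x)) (v - embed f y).
  by rewrite (linear_mapB _ _ Tl) cdotBl cdotBr; ring.
apply: le_trans (cabsD _ _) _.
have nx : cnrm (embed f x) <= cnrm u + 1.
  rewrite (_ : embed f x = u - (u - embed f x)); last by rewrite subKr.
  by rewrite (le_trans (seminormD _ _ _)) // seminormN lerD2l (le_trans ux).
have h1 : cabs (cdot (T (u - embed f x)) v) <= `|M| * e * cnrm v.
  apply: le_trans (cabs_cdot _ _) _.
  rewrite ler_wpM2r ?cnrm_ge0 // (le_trans (TM' _)) //.
  by rewrite ler_wpM2l.
have h2 : cabs (cdot (T (embed f x)) (v - embed f y)) <= `|M| * (cnrm u + 1) * e.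
  apply: le_trans (cabs_cdot _ _) _.
  rewrite ler_pM ?seminorm_ge0 // (le_trans (TM' _)) //.
  by rewrite ler_wpM2l.
by move: (lerD h1 h2); congr (_ <= _); ring.
Qed.

Lemma opbound_adjoint S T (M N : R) : opbound S M -> opbound T N ->
  (forall x y, cdot (S (embed f x)) (embed f y) = cdot (embed f x) (T (embed f y))) ->
  forall u v, cdot (S u) v = cdot u (T v).
Proof.
move=> SM TN ST u v; apply/eqP; rewrite -subr_eq0; apply/eqP.
have [K K0 hK] := cdot_op_approx u v SM; have [L L0 hL] := cdot_op_approx v u TN.
apply: (@cabs_le_eps0 _ _ (K + L)) => e' e0'.
pose e := Num.min e' 1.
have e0 : 0 < e by rewrite lt_min e0' ltr01.
have e1 : e <= 1 by rewrite ge_min lexx orbT.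
have ee : e <= e' by rewrite ge_min lexx.
have [x ux] := embed_dense u e0; have [y vy] := embed_dense v e0.
have e01 : 0 < e <= 1 by rewrite e0 e1.
have h1 := hK e x y e01 ux vy; have h2 := hL e y x e01 vy ux.
rewrite -cabs_conj rmorphB /= -!cdot_herm -ST cabsB in h2.
rewrite (_ : _ - _ = (cdot (S u) v - cdot (S (embed f x)) (embed f y)) +
  (cdot (S (embed f x)) (embed f y) - cdot u (T v))); last by ring.
apply: le_trans (cabsD _ _) _; apply: le_trans (lerD h1 h2) _.
by rewrite -mulrDl ler_wpM2l // addr_ge0.
Qed.

Lemma opbound_eq S T (M N : R) : opbound S M -> opbound T N ->
  (forall x, S (embed f x) = T (embed f x)) -> S =1 T.
Proof.
move=> [Sl SM] [Tl TN] ST u; apply/eqP; rewrite -subr_eq0; apply/eqP/cnrm_eq0.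
apply/eqP; rewrite eq_le cnrm_ge0 andbT.
apply: (@le_eps _ _ _ (`|M| + `|N|)) => e e0.
have [x ux] := embed_dense u e0.
rewrite (_ : S u - T u = S (u - embed f x) - T (u - embed f x)); last first.
  by rewrite (linear_mapB _ _ Sl) (linear_mapB _ _ Tl) ST opprB addrA subrK.
rewrite add0r (le_trans (seminormD _ _ _)) // seminormN mulrDl lerD //.
  apply: le_trans (SM _) _; apply: (@le_trans _ _ (`|M| * cnrm (u - embed f x))).
    by rewrite ler_wpM2r ?cnrm_ge0 // ler_norm.
  by rewrite ler_wpM2l.
apply: le_trans (TN _) _; apply: (@le_trans _ _ (`|N| * cnrm (u - embed f x))).
  by rewrite ler_wpM2r ?cnrm_ge0 // ler_norm.
by rewrite ler_wpM2l.
Qed.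

Lemma opbound_pos S (M : R) : opbound S M ->
  (forall x, 0 <= cdot (S (embed f x)) (embed f x)) ->
  forall u, 0 <= cdot (S u) u.
Proof.
move=> SM pos u; have [K K0 hK] := cdot_op_approx u u SM.
have key (e' : R) : 0 < e' -> exists2 t : R, 0 <= t &
    cabs (cdot (S u) u - t%:C%C) <= K * e'.
  move=> e0'; pose e := Num.min e' 1.
  have e0 : 0 < e by rewrite lt_min e0' ltr01.
  have e1 : e <= 1 by rewrite ge_min lexx orbT.
  have ee : e <= e' by rewrite ge_min lexx.
  have [x ux] := embed_dense u e0.
  exists (Re (cdot (S (embed f x)) (embed f x))); first exact/ge0_Re.
  rewrite -ge0_RRe // (le_trans (hK e x x _ ux ux)) ?e0 ?e1 //.
  by rewrite ler_wpM2l.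
rewrite lecE /=; apply/andP; split; last first.
  apply: (@le_eps _ _ _ K) => e e0; have [t t0 h] := key e e0.
  have := le_trans (ler_normRe _) h; rewrite ReB ler_norml => /andP[] /=; lra.
rewrite -normr_eq0 eq_le normr_ge0 andbT.
apply: (@le_eps _ _ _ K) => e e0; have [t t0 h] := key e e0.
by have := le_trans (ler_normIm _) h; rewrite ImB /= subr0 add0r.
Qed.

(** The antilinear functionals [g_y : x |-> conj (F x y)] are elements of the
    completion, and [T u] is the functional [y |-> <u, g_y>]. *)
Lemma form_operator (F : X -> X -> R[i]) (M : R) : 0 <= M ->
  (forall k x y z, F (k *: x + y) z = k * F x z + F y z) ->
  (forall k x y z, F z (k *: x + y) = Num.conj k * F z x + F z y) ->
  (forall x y, cabs (F x y) <= M * (seminorm f x * seminorm f y)) ->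
  exists2 T, opbound T M & forall x y, cval (T (embed f x)) y = F x y.
Proof.
move=> M0 Fl Fr FM.
have gP y : (fun x => Num.conj (F x y)) \in bounded_antilinear f.
  apply/asboolP; split; first by move=> k x z; rewrite Fl rmorphD rmorphM.
  exists (M * seminorm f y); first by rewrite mulr_ge0 // seminorm_ge0.
  by move=> x; rewrite cabs_conj (le_trans (FM x y)) // mulrAC mulrA.
pose g y : completion f := Completion (gP y).
have gl k x y : g (k *: x + y) = k *: g x + g y.
  by apply: completionP => z; rewrite cvalD cvalZ /= Fr rmorphD rmorphM /= conjCK.
have gn y : cnrm (g y) <= M * seminorm f y.
  apply: cnrm_le => [|x]; first by rewrite mulr_ge0 // seminorm_ge0.
  by rewrite cabs_conj (le_trans (FM x y)) // mulrAC mulrA.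
have ub u : fbound f (fun y => cdot u (g y)) (M * cnrm u).
  move=> y; rewrite (le_trans (cabs_cdot _ _)) //.
  by rewrite [leRHS]mulrAC [leRHS]mulrC ler_wpM2l ?cnrm_ge0.
have TP u : (fun y => cdot u (g y)) \in bounded_antilinear f.
  apply/asboolP; split.
    move=> k x y; rewrite gl.
    by rewrite cdotDr cdotZr.
  by exists (M * cnrm u); [rewrite mulr_ge0 // cnrm_ge0 | exact: ub].
exists (fun u => Completion (TP u)).
  split.
    by move=> k u v; apply: completionP => y; rewrite cvalD cvalZ /= cdot_linear.
  by move=> u; apply: cnrm_le; [rewrite mulr_ge0 // cnrm_ge0 | exact: ub].
by move=> x y /=; rewrite cdot_embedl /= conjCK.
Qed.

End DensityArguments.

Section CommutingPositives.
Variables (R : realType) (X : lmodType R[i]) (f : semi_ip X).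

(** F. Riesz's iteration [h_(k+1) = h_k - h_k^2] writes the positive contraction
    [h] as the strong sum of the [h_k^2], and each [z h_k^2 = h_k z h_k] is
    positive. *)
Lemma commuting_pos (h z : X -> X) (xi : X) :
  linear h -> (forall x y, f (h x) y = f x (h y)) ->
  (forall x, 0 <= f (h x) x) -> (forall x, Re (f (h x) x) <= Re (f x x)) ->
  (forall x, 0 <= f (z x) x) -> (forall x, h (z x) = z (h x)) -> linear z ->
  0 <= Re (f (h (z xi)) xi).
Proof.
move=> hl hs hp h1 zp hz zl.
pose good (g : X -> X) := [/\ linear g, forall x y, f (g x) y = f x (g y),
  forall x, 0 <= Re (f (g x) x) <= Re (f x x) & forall x, g (z x) = z (g x)].
pose next (g : X -> X) x := g x - g (g x).
have goodN g : good g -> good (next g).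
  move=> [gl gs gp gz].
  have sq x : Re (f (g x) (g x)) <= Re (f (g x) x).
    have /andP[a0 _] := gp (x - g x); have /andP[_ b0] := gp (g x).
    move: a0 b0; rewrite (linear_mapB _ _ gl) !(ipBl, ipBr) !ReB (gs (g x) x); lra.
  rewrite /next; split.
  - move=> k x y; rewrite !gl scalerBr opprD !addrA; congr (_ - _).
    by rewrite -!addrA; congr (_ + _); rewrite addrC.
  - by move=> x y; rewrite ipBl ipBr !gs.
  - move=> x; rewrite ipBl ReB (gs (g x)) subr_ge0 sq /=.
    have /andP[_ gx] := gp x; rewrite lerBlDr (le_trans gx) // lerDl.
    exact: Re_ip_ge0.
  - by move=> x; rewrite (linear_mapB _ _ zl) !gz.
pose hk k := iter k next h.
have hkg k : good (hk k).
  elim: k => [|k IH]; last exact: goodN.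
  by split => // x; rewrite ge0_Re ?hp ?h1.
have dec k : Re (f (hk k.+1 (z xi)) xi) <= Re (f (hk k (z xi)) xi).
  have [gl gs gp gz] := hkg k.
  rewrite /hk iterS -/(hk k) {1}/next ipBl ReB gerBl.
  by rewrite gs !gz ge0_Re ?zp.
have decn k : Re (f (hk k (z xi)) xi) <= Re (f (h (z xi)) xi).
  by elim: k => [//|k IH]; rewrite (le_trans (dec k)).
have sumn k : (\sum_(j < k) seminorm f (hk j xi) ^+ 2) + Re (f (hk k xi) xi)
    = Re (f (h xi) xi).
  elim: k => [|k IH]; first by rewrite big_ord0 add0r.
  rewrite big_ord_recr /= -IH /= -addrA; congr (_ + _).
  have [gl gs gp gz] := hkg k.
  by rewrite {1}/next ipBl ReB sqr_seminorm (gs (hk k xi)) addrC subrK.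
have small (e : R) : 0 < e -> exists k, seminorm f (hk k xi) <= e.
  move=> e0; apply: contrapT => /forallNP big.
  have [N hN] : exists N : nat, Re (f xi xi) < N%:R * e ^+ 2.
    exists (Num.truncn (Re (f xi xi) / e ^+ 2)).+1.
    by rewrite -ltr_pdivrMr ?exprn_gt0 // truncnS_gt.
  have := sumn N; have [_ _ /(_ xi)/andP[p _] _] := hkg N; move=> s.
  have : N%:R * e ^+ 2 <= \sum_(j < N) seminorm f (hk j xi) ^+ 2.
    rewrite mulr_natl -[leLHS](_ : \sum_(j < N) e ^+ 2 = _); last first.
      by rewrite sumr_const card_ord.
    apply: ler_sum => j _; rewrite ler_pXn2r ?nnegrE ?seminorm_ge0 // ltW //.
    by rewrite ltNge; apply/negP/big.
  have := h1 xi; lra.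
apply: (@le_eps _ _ _ (seminorm f (z xi))) => e e0.
have [k hke] := small e e0; have [gl gs gp gz] := hkg k.
rewrite -lerBlDr sub0r (le_trans _ (decn k)) // gs.
have := le_trans (ler_normRe _) (cabs_ip f (z xi) (hk k xi)).
have := ler_wpM2l (seminorm_ge0 f (z xi)) hke.
rewrite ler_norml => ? /andP[]; lra.
Qed.

End CommutingPositives.

(** * Elementary C*-algebra *)

Section CStarBasics.
Variables (R : realType) (A : cstarType R).
Implicit Types (x y z : A) (k : R[i]) (t s r : R).

Local Ltac lmod := lmod_over (R[i] : comNzRingType).

Lemma starD x y : star (x + y) = star x + star y.
Proof. by have := star_antilinear 1 x y; rewrite rmorph1 !scale1r. Qed.

Lemma star0 : star (0 : A) = 0.
Proof. by apply: (addrI (star 0)); rewrite -starD !addr0. Qed.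

Lemma starZ k x : star (k *: x) = Num.conj k *: star x.
Proof. by have := star_antilinear k x 0; rewrite !addr0 star0 addr0. Qed.

Lemma starZR t x : star (t%:C%C *: x) = t%:C%C *: star x.
Proof. by rewrite starZ conj_real. Qed.

Lemma starN x : star (- x) = - star x.
Proof. by rewrite -scaleN1r starZ rmorphN rmorph1 scaleN1r. Qed.

Lemma starB x y : star (x - y) = star x - star y.
Proof. by rewrite starD starN. Qed.

Lemma star1 : star (1 : A) = 1.
Proof. by rewrite -[LHS]mulr1 -{2}[1]starK -starM mulr1 starK. Qed.

Lemma starX x n : star (x ^+ n) = star x ^+ n.
Proof. by elim: n => [|n IH]; rewrite ?expr0 ?star1 // exprS starM IH -exprSr. Qed.

Lemma cnormZc k x : cnorm (k *: x) = cabs k * cnorm x.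
Proof. exact: cnormZ. Qed.

Lemma cnormZR t x : cnorm (t%:C%C *: x) = `|t| * cnorm x.
Proof. by rewrite cnormZc cabs_real. Qed.

Lemma cnorm0 : cnorm (0 : A) = 0.
Proof. by rewrite -(scale0r (0 : A)) cnormZc cabs0 mul0r. Qed.

Lemma cnormN x : cnorm (- x) = cnorm x.
Proof. by rewrite -scaleN1r cnormZc cabsN cabs1 mul1r. Qed.

Lemma cnorm_ge0 x : 0 <= cnorm x.
Proof.
have := ler_cnormD x (- x); rewrite subrr cnorm0 cnormN; lra.
Qed.

Lemma cnormB x y : cnorm (x - y) = cnorm (y - x).
Proof. by rewrite -cnormN opprB. Qed.

Lemma ler_cnormB x y : cnorm (x - y) <= cnorm x + cnorm y.
Proof. by rewrite -(cnormN y) ler_cnormD. Qed.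

Lemma cnorm_eq0 x : (cnorm x == 0) = (x == 0).
Proof. by apply/eqP/eqP => [/cnorm0_eq0//|->]; exact: cnorm0. Qed.

Lemma cnorm_star x : cnorm (star x) = cnorm x.
Proof.
have h y : cnorm y <= cnorm (star y).
  have [->|y0] := eqVneq y 0; first by rewrite star0.
  have := ler_cnormM (star y) y; rewrite cnorm_starM expr2.
  by rewrite ler_pM2r // lt_def cnorm_eq0 y0 cnorm_ge0.
by apply/eqP; rewrite eq_le h andbT -{2}[x]starK h.
Qed.

Lemma cnorm1 : cnorm (1 : A) = 1.
Proof.
have := cnorm_starM (1 : A); rewrite star1 mulr1 expr2 => h.
have n0 : cnorm (1 : A) != 0 by rewrite cnorm_eq0 oner_eq0.
by apply: (mulIf n0); rewrite mul1r.
Qed.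

Lemma cnorm_sa_sqr x : selfadjoint x -> cnorm (x * x) = cnorm x ^+ 2.
Proof. by move=> xs; rewrite -cnorm_starM xs. Qed.

Lemma selfadjointD x y : selfadjoint x -> selfadjoint y -> selfadjoint (x + y).
Proof. by rewrite /selfadjoint starD => -> ->. Qed.

Lemma selfadjointN x : selfadjoint x -> selfadjoint (- x).
Proof. by rewrite /selfadjoint starN => ->. Qed.

Lemma selfadjointB x y : selfadjoint x -> selfadjoint y -> selfadjoint (x - y).
Proof. by rewrite /selfadjoint starB => -> ->. Qed.

Lemma selfadjointZ t x : selfadjoint x -> selfadjoint (t%:C%C *: x).
Proof. by rewrite /selfadjoint starZR => ->. Qed.

Lemma selfadjoint1 : selfadjoint (1 : A). Proof. exact: star1. Qed.

Lemma selfadjoint0 : selfadjoint (0 : A). Proof. exact: star0. Qed.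

Lemma selfadjointM x y : selfadjoint x -> selfadjoint y -> x * y = y * x ->
  selfadjoint (x * y).
Proof. by rewrite /selfadjoint starM => -> -> ->. Qed.

Lemma selfadjoint_starM x : selfadjoint (star x * x).
Proof. by rewrite /selfadjoint starM starK. Qed.

(** Increments dominated by those of a bounded increasing real sequence are
    summable. *)
Lemma cnorm_limit (u : nat -> A) (t : nat -> R) (l : R) :
  (forall n, t n <= t n.+1) -> (forall n, t n <= l) ->
  (forall n, cnorm (u n.+1 - u n) <= t n.+1 - t n) ->
  exists v, forall e : R, 0 < e -> exists n, cnorm (u n - v) <= e
    /\ cnorm (u n.+1 - v) <= e.
Proof.
move=> tm tl ut.
have tm' m n : (m <= n)%N -> t m <= t n.
  by move/subnKC <-; elim: (n - m)%N => [|k IH]; rewrite ?addn0 // addnS (le_trans IH).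
have um m n : (m <= n)%N -> cnorm (u n - u m) <= t n - t m.
  move/subnKC <-; elim: (n - m)%N => [|k IH]; first by rewrite addn0 subrr cnorm0 subrr.
  rewrite addnS; have := ler_cnormD (u (m + k).+1 - u (m + k)%N) (u (m + k)%N - u m).
  by rewrite addrA subrK; have := ut (m + k)%N; lra.
pose S := range t.
have Ss : has_sup S by split; [exists (t 0%N), 0%N | exists l => _ [n _ <-]].
have small (e : R) : 0 < e -> exists N, forall n, (N <= n)%N -> cnorm (u n - u N) < e.
  move=> e0; have [_ [N _ <-] hN] := sup_adherent e0 Ss.
  exists N => n Nn; apply: le_lt_trans (um _ _ Nn) _.
  have : t n <= sup S by apply: ub_le_sup; [exact: Ss.2 | exists n].
  lra.
have [v uv] : exists v, cnorm (u n - v) @[n --> \oo] --> (0 : R).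
  apply: cnorm_complete => e e0.
  have [N hN] := small _ (divr_gt0 e0 (ltr0n R 2)).
  exists N => m n Nm Nn; have := ler_cnormB (u m - u N) (u n - u N).
  rewrite opprB addrA subrK => /le_lt_trans; apply.
  have := hN _ Nm; have := hN _ Nn.
  have aux (a b c : R) : a < c / 2 -> b < c / 2 -> b + a < c by lra.
  exact: aux.
exists v => e e0; move/cvgrPdist_le: uv => /(_ _ e0)[N _ hN].
exists N; split; [have := hN N (leqnn N) | have := hN N.+1 (leqnSn N)];
  by rewrite /= sub0r normrN ger0_norm // cnorm_ge0.
Qed.

(** The square root of [1 - z], as the limit of the iteration
    [w <- (z + w^2) / 2].  Its increments are dominated by those of the
    scalar iteration for [z = 1], which is increasing and bounded by [1]; hence
    the iteration converges up to the boundary [|z| = 1], and [|1 - q| <= 1]. *)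
Lemma sqrt_one_sub z : selfadjoint z -> cnorm z <= 1 ->
  exists q, [/\ selfadjoint q, q * q = 1 - z, cnorm (1 - q) <= 1 &
    forall c, c * z = z * c -> c * q = q * c].
Proof.
move=> zs z1.
pose next w : A := (2^-1)%:C%C *: (z + w * w).
pose w n := iter n next 0.
pose t n := iter n (fun s : R => 2^-1 * (1 + s * s)) 0.
have wS n : w n.+1 = next (w n) by [].
have tS n : t n.+1 = 2^-1 * (1 + t n * t n) by [].
have t01 n : 0 <= t n <= 1.
  elim: n => [|n /andP[IH1 IH2]]; first by rewrite lexx ler01.
  by rewrite tS; apply/andP; split; nra.
have tm n : t n <= t n.+1 by rewrite tS; have := sqr_ge0 (t n - 1); lra.
have ws n : selfadjoint (w n).
  elim: n => [|n IH]; first exact: selfadjoint0.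
  by apply: selfadjointZ; apply: selfadjointD => //; exact: selfadjointM.
have wc c n : c * z = z * c -> c * w n = w n * c.
  move=> cz; elim: n => [|n IH]; first by rewrite mulr0 mul0r.
  rewrite wS /next -scalerAl -scalerAr mulrDl mulrDr cz; congr (_ *: (_ + _)).
  by rewrite mulrA IH -!mulrA IH.
have wz n : w n * z = z * w n by rewrite wc.
have ww m n : w m * w n = w n * w m by apply: wc; rewrite wz.
have half (x : A) : cnorm ((2^-1)%:C%C *: x) = 2^-1 * cnorm x.
  by rewrite cnormZR ger0_norm.
have wt n : cnorm (w n) <= t n.
  elim: n => [|n IH]; first by rewrite cnorm0.
  rewrite wS half tS ler_wpM2l // (le_trans (ler_cnormD _ _)) // lerD //.
  by rewrite (le_trans (ler_cnormM _ _)) // ler_pM // cnorm_ge0.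
have inc n : cnorm (w n.+1 - w n) <= t n.+1 - t n.
  elim: n => [|n IH]; first by rewrite subr0 (le_trans (wt 1%N)) // lerDl oppr0.
  rewrite 2!wS -wS /next -scalerBr half.
  have -> : z + w n.+1 * w n.+1 - (z + w n * w n) =
      (w n.+1 - w n) * (w n.+1 + w n).
    by rewrite mulrBl !mulrDr (ww n n.+1); lmod.
  have h1 := ler_cnormM (w n.+1 - w n) (w n.+1 + w n).
  have h2 := ler_cnormD (w n.+1) (w n).
  have h3 := wt n; have h4 := wt n.+1.
  have h5 : cnorm (w n.+1 + w n) <= t n.+1 + t n by lra.
  have h6 := ler_pM (cnorm_ge0 _) (cnorm_ge0 _) IH h5.
  have -> : t n.+2 - t n.+1 = 2^-1 * ((t n.+1 - t n) * (t n.+1 + t n)).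
    by rewrite (tS n.+1) {3}(tS n); ring.
  by rewrite ler_wpM2l // (le_trans h1 h6).
have tl n : t n <= 1 by have /andP[] := t01 n.
have [v hv] := cnorm_limit tm tl inc.
have lim0 x : (forall e : R, 0 < e -> cnorm x <= 8 * e) -> x = 0.
  move=> h; apply/eqP; rewrite -cnorm_eq0 eq_le cnorm_ge0 andbT.
  by apply: (@le_eps _ _ _ 8) => e e0; rewrite add0r h.
have v1 : cnorm v <= 1.
  apply: (@le_eps _ _ _ 1) => e e0; have [n [h _]] := hv e e0.
  rewrite (_ : v = w n - (w n - v)); last by rewrite subKr.
  by rewrite mul1r (le_trans (ler_cnormB _ _)) // lerD // (le_trans (wt n)).
have vs : selfadjoint v.
  apply/eqP; rewrite -subr_eq0; apply/eqP/lim0 => e e0; have [n [h _]] := hv e e0.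
  rewrite (_ : star v - v = (w n - v) - star (w n - v)); last first.
    by rewrite starB ws; lmod.
  rewrite (le_trans (ler_cnormB _ _)) // cnorm_star.
  by move: h; move: (cnorm _) => a; lra.
have vc c : c * z = z * c -> c * v = v * c.
  move=> cz; apply/eqP; rewrite -subr_eq0; apply/eqP/lim0 => e' e0'.
  have c0 := cnorm_ge0 c.
  have e0 : 0 < e' / (cnorm c + 1) by rewrite divr_gt0 // ltr_wpDl.
  have [n [h _]] := hv _ e0.
  have -> : c * v - v * c = (w n - v) * c - c * (w n - v).
    by rewrite mulrBl mulrBr wc //; lmod.
  have h1 := ler_cnormM (w n - v) c; have h2 := ler_cnormM c (w n - v).
  have h3 : cnorm (w n - v) * cnorm c <= e'.
    apply: (@le_trans _ _ (e' / (cnorm c + 1) * (cnorm c + 1))).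
      by rewrite ler_pM ?cnorm_ge0 // lerDl.
    by rewrite divfK // gt_eqF // ltr_wpDl.
  rewrite (le_trans (ler_cnormB _ _)) //; move: h1 h2 h3; rewrite [cnorm c * _]mulrC.
  by move: (cnorm _ * _) => a; have := ltW e0'; lra.
have fix_v : (2%:C)%C *: v = z + v * v.
  apply/eqP; rewrite -subr_eq0; apply/eqP/lim0 => e0' e0'0.
  pose e := Num.min e0' 1.
  have e0 : 0 < e by rewrite lt_min e0'0 ltr01.
  have e1 : e <= 1 by rewrite ge_min lexx orbT.
  have ee : e <= e0' by rewrite ge_min lexx.
  have [n [h h']] := hv _ e0.
  have -> : (2%:C)%C *: v - (z + v * v) =
     (w n - v) * w n + v * (w n - v) - (2%:C)%C *: (w n.+1 - v).
    by rewrite wS /next scalerBr scalerA -rmorphM /= divff // mulrBl mulrBr; lmod.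
  apply: le_trans (ler_cnormB _ _) _; rewrite cnormZR ger0_norm //.
  have h1 := ler_cnormD ((w n - v) * w n) (v * (w n - v)).
  have h2 := ler_cnormM (w n - v) (w n); have h3 := ler_cnormM v (w n - v).
  have h4 : cnorm (w n - v) * cnorm (w n) <= e * 1.
    by rewrite ler_pM ?cnorm_ge0 // (le_trans (wt n)).
  have h5 : cnorm v * cnorm (w n - v) <= 1 * e by rewrite ler_pM ?cnorm_ge0.
  lra.
exists (1 - v); split.
- by apply: selfadjointB => //; exact: selfadjoint1.
- have -> : (1 - v) * (1 - v) = 1 - (2%:C)%C *: v + v * v.
    by rewrite mulrBl mul1r mulrBr mulr1; lmod.
  by rewrite fix_v; lmod.
- by rewrite subKr.
- by move=> c cz; rewrite mulrBr mulrBl mulr1 mul1r vc.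
Qed.

End CStarBasics.

(** * The cone of positive elements *)

Section PositiveCone.
Variables (R : realType) (A : cstarType R).
Implicit Types (x y z : A) (t s r : R).

Local Ltac lmod := lmod_over (R[i] : comNzRingType).
Local Notation "t %:S" := (t%:C%C *: (1 : A)) (at level 2, format "t %:S").

(** For self-adjoint [x] and [t >= |x|], the condition [|t - x| <= t] says that
    the spectrum of [x] is nonnegative.  In this form positivity is visibly stable
    under sums and does not depend on the ambient algebra. *)
Definition pcone x := selfadjoint x /\ exists t, cnorm (t%:S - x) <= t.

Lemma scalar_sa t : selfadjoint t%:S.
Proof. exact/selfadjointZ/selfadjoint1. Qed.

Lemma cnorm_scalar t : cnorm t%:S = `|t|.
Proof. by rewrite cnormZR cnorm1 mulr1. Qed.

Lemma scalarM t x : t%:S * x = t%:C%C *: x.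
Proof. by rewrite -scalerAl mul1r. Qed.

Lemma scalarMr t x : x * t%:S = t%:C%C *: x.
Proof. by rewrite -scalerAr mulr1. Qed.

Lemma pcone_ge x t s : t <= s -> cnorm (t%:S - x) <= t -> cnorm (s%:S - x) <= s.
Proof.
move=> ts h; rewrite (_ : s%:S - x = (t%:S - x) + (s - t)%:S); last first.
  by rewrite rmorphB /=; lmod.
apply: le_trans (ler_cnormD _ _) _.
by rewrite cnorm_scalar ger0_norm ?subr_ge0 //; move: h; lra.
Qed.

Lemma pcone_ex x : pcone x -> exists2 t, 0 < t & cnorm (t%:S - x) <= t.
Proof.
move=> [_ [t h]]; exists (t + 1); last by apply: pcone_ge h; rewrite lerDl.
by rewrite ltr_wpDl // (le_trans (cnorm_ge0 _) h).
Qed.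

Lemma pconeD x y : pcone x -> pcone y -> pcone (x + y).
Proof.
move=> [xs [t xt]] [ys [s yt]]; split; first exact: selfadjointD.
exists (t + s); rewrite (_ : _ - _ = (t%:S - x) + (s%:S - y)); last first.
  by rewrite rmorphD /=; lmod.
by rewrite (le_trans (ler_cnormD _ _)) // lerD.
Qed.

Lemma pconeZ r x : 0 <= r -> pcone x -> pcone (r%:C%C *: x).
Proof.
move=> r0 [xs [t xt]]; split; first exact: selfadjointZ.
exists (r * t); rewrite (_ : _ - _ = r%:C%C *: (t%:S - x)); last first.
  by rewrite rmorphM /=; lmod.
by rewrite cnormZR ger0_norm // ler_wpM2l.
Qed.

Lemma pcone_scalar t : 0 <= t -> pcone t%:S.
Proof. by move=> t0; split; [exact: scalar_sa | exists t; rewrite subrr cnorm0]. Qed.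

Lemma pcone0 : pcone (0 : A).
Proof. by split; [exact: selfadjoint0 | exists 0; rewrite scale0r subrr cnorm0]. Qed.

Lemma pcone_cnorm x : selfadjoint x -> pcone ((cnorm x)%:S - x).
Proof.
move=> xs; split; first by apply: selfadjointB => //; exact: scalar_sa.
by exists (cnorm x); rewrite subKr.
Qed.

Lemma pcone_sqrt x : pcone x -> exists u, [/\ selfadjoint u, u * u = x, pcone u &
  forall c, c * x = x * c -> c * u = u * c].
Proof.
move=> xP; have [t t0 xt] := pcone_ex xP; have xs := xP.1.
have tn0 : t != 0 by rewrite gt_eqF.
pose z : A := 1 - (t^-1)%:C%C *: x.
have zs : selfadjoint z.
  by apply: selfadjointB; [exact: selfadjoint1 | exact: selfadjointZ].
have z1 : cnorm z <= 1.
  rewrite (_ : z = (t^-1)%:C%C *: (t%:S - x)); last first.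
    by rewrite scalerBr scalerA -rmorphM /= mulVf // scale1r.
  by rewrite cnormZR gtr0_norm ?invr_gt0 // ler_pdivrMl // mulr1.
have [q [qs qq q1 qc]] := sqrt_one_sub zs z1.
have s0 := sqrtr_ge0 t.
exists ((Num.sqrt t)%:C%C *: q); split.
- exact: selfadjointZ.
- rewrite -scalerAl -scalerAr scalerA -rmorphM /= -expr2 sqr_sqrtr ?ltW // qq.
  by rewrite subKr scalerA -rmorphM /= divff // scale1r.
- split; first exact: selfadjointZ.
  exists (Num.sqrt t); rewrite -scalerBr cnormZR ger0_norm //.
  by rewrite ler_piMr.
- move=> c cx; rewrite -scalerAl -scalerAr qc //.
  by rewrite /z mulrBr mulrBl mulr1 mul1r -scalerAl -scalerAr cx.
Qed.

(** With [u = p + i q] one has [u' u = p^2 + q^2 = r^2], so [|u| = r], and [p] is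
    the real part of [u]. *)
Lemma cnorm_sqr_sum p q r : selfadjoint p -> selfadjoint q -> p * q = q * p ->
  0 <= r -> p * p + q * q = (r ^+ 2)%:S -> cnorm p <= r.
Proof.
move=> ps qs pq r0 h; pose u := p + 'i *: q.
have us : star u = p - 'i *: q by rewrite starD starZ ps qs conjCi scaleNr.
have un : cnorm u = r.
  have : cnorm u ^+ 2 = r ^+ 2.
    rewrite -cnorm_starM us mulrBl !mulrDr -!scalerAl -!scalerAr pq scalerA.
    rewrite mulCii scaleN1r (_ : _ - _ = p * p + q * q); last by lmod.
    by rewrite h cnorm_scalar ger0_norm // sqr_ge0.
  move/eqP; rewrite eqrXn2 ?cnorm_ge0 // => /eqP //.
rewrite (_ : p = (2^-1)%:C%C *: (u + star u)); last first.
  have -> : u + star u = (2%:C)%C *: p by rewrite us /u; lmod.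
  by rewrite scalerA -rmorphM /= mulVf // scale1r.
rewrite cnormZR ger0_norm // ler_pdivrMl // mulr_natl mulr2n.
by rewrite (le_trans (ler_cnormD _ _)) // cnorm_star un.
Qed.

(** After scaling to [|x| <= 1], let [q] be the square root of [1 - x^2]; then
    [x + i q] is unitary, so [|1 - x^2| = |q^2| <= 1]. *)
Lemma pcone_sqr x : selfadjoint x -> pcone (x * x).
Proof.
move=> xs; have [->|x0] := eqVneq x 0; first by rewrite mulr0; exact: pcone0.
have r0 : 0 < cnorm x by rewrite lt_def cnorm_eq0 x0 cnorm_ge0.
set r := cnorm x in r0 *; have rn0 : r != 0 by rewrite gt_eqF.
pose y := (r^-1)%:C%C *: x.
have ys : selfadjoint y by exact: selfadjointZ.
have y1 : cnorm y = 1 by rewrite cnormZR gtr0_norm ?invr_gt0 // mulVf.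
have yys : selfadjoint (y * y) by exact: selfadjointM.
have yy1 : cnorm (y * y) <= 1 by rewrite cnorm_sa_sqr // y1 expr1n.
have [q [qs qq _ qc]] := sqrt_one_sub yys yy1.
have q1 : cnorm q <= 1.
  apply: (@cnorm_sqr_sum q y) => //; first by rewrite qc ?mulrA.
  by rewrite qq subrK expr1n scale1r.
rewrite (_ : x * x = (r ^+ 2)%:C%C *: (y * y)); last first.
  rewrite -scalerAl -scalerAr !scalerA -!rmorphM /=.
  by rewrite (_ : r ^+ 2 * _ * _ = 1) ?scale1r //; field.
apply: pconeZ; first exact: sqr_ge0.
split => //; exists 1; rewrite scale1r -qq (le_trans (ler_cnormM _ _)) //.
by rewrite -[leRHS](mulr1 1) ler_pM ?cnorm_ge0.
Qed.

Lemma pcone_scalar_ge0 t : pcone t%:S -> 0 <= t.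
Proof.
move=> [_ [s]]; rewrite -scalerBl -rmorphB /= cnorm_scalar.
by move/(le_trans (ler_norm _)); lra.
Qed.

(** Write [r - x = u^2] and [r + x = w^2] with commuting [u] and [w]; then
    [x^2 + (u w)^2 = r^2]. *)
Lemma pcone_cnorm_le x r : selfadjoint x -> pcone (r%:S - x) -> pcone (r%:S + x) ->
  cnorm x <= r.
Proof.
move=> xs rm rp.
have r0 : 0 <= r.
  have := pconeD rm rp; rewrite (_ : _ - _ + _ = (r + r)%:S); last first.
    by rewrite rmorphD /=; lmod.
  by move/pcone_scalar_ge0; lra.
have [u [us uu _ uc]] := pcone_sqrt rm; have [w [ws ww _ wc]] := pcone_sqrt rp.
have ux : u * x = x * u.
  by rewrite uc // mulrBr mulrBl scalarM scalarMr.
have uw : u * w = w * u.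
  by apply: wc; rewrite mulrDr mulrDl scalarM scalarMr ux.
have xw : x * w = w * x by apply: wc; rewrite mulrDr mulrDl scalarM scalarMr.
apply: (@cnorm_sqr_sum x (u * w)) => //.
- exact: selfadjointM.
- by rewrite mulrA -ux -mulrA xw mulrA.
- have -> : u * w * (u * w) = (u * u) * (w * w).
    by rewrite -!mulrA; congr (_ * _); rewrite !mulrA uw.
  rewrite uu ww mulrBl !mulrDr scalarM scalarMr !scalarM scalerA -rmorphM /= -expr2.
  by lmod.
Qed.

Lemma sa_sqr_eq0 x : selfadjoint x -> x * x = 0 -> x = 0.
Proof.
move=> xs /(congr1 (@cnorm _ _)); rewrite cnorm_sa_sqr // cnorm0 => /eqP.
by rewrite expf_eq0 /= => /eqP; exact: cnorm0_eq0.
Qed.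

Lemma pcone_anti x : pcone x -> pcone (- x) -> x = 0.
Proof.
move=> xP xN; apply: cnorm0_eq0; apply/eqP; rewrite eq_le cnorm_ge0 andbT.
by apply: pcone_cnorm_le; rewrite ?scale0r ?sub0r ?add0r //; exact: xP.1.
Qed.

Lemma bernoulli_le (d : R) n : 0 <= d -> 1 + n%:R * d <= (1 + d) ^+ n.
Proof.
move=> d0; elim: n => [|n IH]; first by rewrite mul0r addr0 expr0.
have := ler_wpM2l (addr_ge0 ler01 d0) IH; rewrite -exprS; apply: le_trans.
have : 0 <= n%:R * (d * d) by rewrite mulr_ge0 ?ler0n // mulr_ge0.
rewrite -(natr1 n); lra.
Qed.

(** By Bernoulli's inequality [rho^(2^k)] grows at least like [4^k] when
    [rho > 1]. *)
Lemma power_growth (rho c : R) : 0 <= c ->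
  (forall k, rho ^+ (2 ^ k) <= 1 + (2 ^ k)%:R * c) -> rho <= 1.
Proof.
move=> c0 h; rewrite leNgt; apply/negP => rho1.
pose d := rho - 1; have d0 : 0 < d by rewrite subr_gt0.
have rhoE : rho = 1 + d by rewrite /d addrC subrK.
pose k := (Num.truncn ((1 + 2 * c) / d ^+ 2)).+1.
have Nk : (1 + 2 * c) < (2 ^ k)%:R * d ^+ 2.
  rewrite -ltr_pdivrMr ?exprn_gt0 //; apply: (lt_le_trans (truncnS_gt _)).
  by rewrite ler_nat ltnW // ltn_expl.
have N1 : 1 <= (2 ^ k)%:R :> R by rewrite ler1n expn_gt0.
have := h k.+1; rewrite expnSr exprM.
have := bernoulli_le (2 ^ k) (ltW d0); rewrite -rhoE natrM.
set N := (2 ^ k)%:R in Nk N1 *; set q := rho ^+ _ => hq hk.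
have Nd0 : 0 <= N * d by rewrite mulr_ge0 ?ltW // (lt_le_trans ltr01).
have h2 : (N * d) ^+ 2 <= q ^+ 2.
  by rewrite ler_pXn2r ?nnegrE //; lra.
have h3 : N * (1 + 2 * c) < N * (N * d ^+ 2).
  by rewrite ltr_pM2l // (lt_le_trans ltr01).
have : N * c * 2 >= 0 by rewrite !mulr_ge0 // (le_trans ler01).
move: h2; rewrite exprMn expr2; lra.
Qed.

Lemma cnorm_sa_pow2 x k : selfadjoint x -> cnorm (x ^+ (2 ^ k)) = cnorm x ^+ (2 ^ k).
Proof.
move=> xs; elim: k => [|k IH]; first by rewrite !expr1.
rewrite expnSr !exprM -IH expr2 cnorm_sa_sqr //.
by rewrite /selfadjoint starX xs.
Qed.

(** With [z'] the adjoint of [z], the elements [z' z] and [z z'] have the same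
    nonzero spectrum.  Only norms of powers are compared here, through
    [(1 + z z')^n = 1 + z (sum_(k < n) (1 + z' z)^k) z']. *)
Lemma cnorm_one_swap z : cnorm (1 + star z * z) <= 1 -> cnorm (1 + z * star z) <= 1.
Proof.
move=> h; set S := 1 + star z * z in h; set T := 1 + z * star z.
pose G n := \sum_(k < n) S ^+ k.
have GS n : G n.+1 = 1 + G n * S.
  rewrite /G big_ord_recl expr0 mulr_suml; congr (_ + _).
  by apply: eq_bigr => k _; rewrite lift0 exprSr.
have TG n : T ^+ n = 1 + z * G n * star z.
  elim: n => [|n IH]; first by rewrite /G big_ord0 mulr0 mul0r addr0.
  rewrite exprSr IH GS /T /S !(mulrDl, mulrDr) !(mul1r, mulr1) !mulrA.
  by lmod.
have Sk k : cnorm (S ^+ k) <= 1.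
  elim: k => [|k IH]; first by rewrite expr0 cnorm1.
  rewrite exprS (le_trans (ler_cnormM _ _)) // -[leRHS](mulr1 1).
  by rewrite ler_pM ?cnorm_ge0.
have Gn n : cnorm (G n) <= n%:R.
  elim: n => [|n IH]; first by rewrite /G big_ord0 cnorm0.
  by rewrite /G big_ord_recr /= (le_trans (ler_cnormD _ _)) // -natr1 lerD.
apply: (@power_growth _ (cnorm z ^+ 2)); first exact: sqr_ge0.
move=> k; rewrite -cnorm_sa_pow2; last first.
  by apply: selfadjointD; [exact: selfadjoint1 | rewrite /selfadjoint starM starK].
rewrite TG (le_trans (ler_cnormD _ _)) // cnorm1 lerD2l.
rewrite (le_trans (ler_cnormM _ _)) // cnorm_star.
apply: (@le_trans _ _ ((cnorm z * (2 ^ k)%:R) * cnorm z)).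
  rewrite ler_wpM2r ?cnorm_ge0 // (le_trans (ler_cnormM _ _)) //.
  by rewrite ler_wpM2l ?cnorm_ge0.
by rewrite mulrAC mulrC expr2.
Qed.

Lemma pcone_swap z : pcone (- (star z * z)) -> pcone (- (z * star z)).
Proof.
move=> /pcone_ex[t t0]; rewrite opprK => h; split.
  by apply: selfadjointN; rewrite /selfadjoint starM starK.
exists t; rewrite opprK; pose s := Num.sqrt t.
have s0 : 0 < s by rewrite sqrtr_gt0.
have ss : s * s = t by rewrite -expr2 sqr_sqrtr // ltW.
pose y := (s^-1)%:C%C *: z.
have E u v : star u = v -> t%:S + v * u =
    t%:C%C *: (1 + star ((s^-1)%:C%C *: u) * ((s^-1)%:C%C *: u)).
  move=> <-; rewrite scalerDr starZR -scalerAl -scalerAr !scalerA -!rmorphM /=.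
  rewrite (_ : t * _ * _ = 1) ?scale1r //.
  by rewrite -ss; field; rewrite gt_eqF.
rewrite (E (star z) z (starK z)) cnormZR gtr0_norm // ger_pMr //.
rewrite starZR starK -starZR; apply: (@cnorm_one_swap y).
by move: h; rewrite (E z) // cnormZR gtr0_norm // ger_pMr.
Qed.

(** Kaplansky's theorem.  Put [x = y' y] with [y'] the adjoint of [y], let
    [a = |x|], and let [m = a - x] be twice the negative part of [x].  Then
    [z = y m] satisfies [z' z = - a m^2 <= 0], hence [z z' <= 0]; but
    [z' z + z z'] is a sum of two squares, so [z' z >= 0] as well.  Therefore
    [m = 0] and [x = a]. *)
Lemma pcone_starM y : pcone (star y * y).
Proof.
set x := star y * y; have xs : selfadjoint x by exact: selfadjoint_starM.
have [a [as_ aa aP ac]] := pcone_sqrt (pcone_sqr xs).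
have [r [rs rr _ rc]] := pcone_sqrt aP.
have ax : a * x = x * a by rewrite ac // mulrA.
have rx : r * x = x * r by rewrite rc // ax.
have ra : r * a = a * r by rewrite rc.
pose m := a - x.
have ms : selfadjoint m by exact: selfadjointB.
have rm : r * m = m * r by rewrite mulrBr mulrBl ra rx.
have am : a * m = m * a by rewrite mulrBr mulrBl ax.
have mxm : m * x * m = - ((r * m) * (r * m)).
  have -> : m * x = - (a * m) by rewrite mulrBl -aa mulrBr; lmod.
  by rewrite mulNr -rr -!mulrA; congr (- (r * _)); rewrite !mulrA rm.
pose z := y * m.
have zz : star z * z = m * x * m by rewrite starM ms !mulrA.
have zN : pcone (- (star z * z)).
  by rewrite zz mxm opprK; apply: pcone_sqr; exact: selfadjointM.
have zP : pcone (star z * z).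
  pose p := z + star z; pose q := 'i *: (z - star z).
  have ps : selfadjoint p by rewrite /selfadjoint starD starK addrC.
  have qs : selfadjoint q.
    by rewrite /selfadjoint starZ conjCi starB starK scaleNr -scalerN opprB.
  have -> : star z * z = (2^-1)%:C%C *: (p * p + q * q) + (- (z * star z)).
    have -> : p * p + q * q = (2%:C)%C *: (z * star z + star z * z).
      rewrite -scalerAl -scalerAr scalerA mulCii scaleN1r.
      by rewrite !(mulrDl, mulrDr, mulrN, mulNr, opprK); lmod.
    by rewrite scalerA -rmorphM /= mulVf // scale1r; lmod.
  apply: pconeD; last exact: pcone_swap.
  by apply: pconeZ => //; apply: pconeD; exact: pcone_sqr.
have rm0 : r * m = 0.
  apply: sa_sqr_eq0; first exact: selfadjointM.
  by rewrite -[_ * _]opprK -mxm -zz (pcone_anti zP zN) oppr0.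
have am0 : a * m = 0 by rewrite -rr -mulrA rm0 mulr0.
have m0 : m = 0.
  apply: sa_sqr_eq0 => //.
  have -> : m * m = a * m + a * m.
    have xm : x * m = - (a * m) by rewrite !mulrBr -aa ax; lmod.
    by rewrite {1}/m mulrBl xm opprK.
  by rewrite am0 addr0.
by move/eqP: m0; rewrite subr_eq0 => /eqP <-.
Qed.

End PositiveCone.

(** * Separating a point from a cone with an order unit *)

Section Separation.
Variables (R : realType) (V : lmodType R[i]).
Implicit Types (K M N : set V) (u v w x y e : V) (s t : R).

Local Ltac lmod := lmod_over (R[i] : comNzRingType).

Definition convex_cone K := [/\ K 0, forall x y, K x -> K y -> K (x + y)
  & forall t x, 0 <= t -> K x -> K (t%:C%C *: x)].

(** A cone maximal among those avoiding [e] is a half-space: if it contained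
    neither [v] nor [-v], enlarging it by either would capture [e], and [e] would
    be a positive combination of two of its elements. *)
Lemma maximal_cone K e : convex_cone K -> ~ K e ->
  exists M, [/\ convex_cone M, K `<=` M, ~ M e & forall v, M v \/ M (- v)].
Proof.
move=> cK Ke.
pose P M := convex_cone (M `|` K) /\ ~ (M `|` K) e.
have [|A [[cA Ae] Amax]] := @Zorn_bigcup V P.
  move=> F FP Ftot.
  have ex2 x y : (\bigcup_(X in F) X `|` K) x -> (\bigcup_(X in F) X `|` K) y ->
      (exists2 X, F X & (X `|` K) x /\ (X `|` K) y) \/ (K x /\ K y).
    move=> [[X FX Xx]|Kx] [[Y FY Yy]|Ky].
    - left; case: (Ftot _ _ FX FY) => h; [exists Y|exists X] => //.
        by split; left => //; exact: h.
      by split; left => //; exact: h.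
    - by left; exists X => //; split; [left|right].
    - by left; exists Y => //; split; [right|left].
    - by right.
  have sub X x : F X -> (X `|` K) x -> (\bigcup_(X in F) X `|` K) x.
    by move=> FX [Xx|Kx]; [left; exists X | right].
  have [K0 KD KZ] := cK; split; [split|].
  - by right.
  - move=> x y Ux Uy; have [[X FX [Xx Xy]]|[Kx Ky]] := ex2 _ _ Ux Uy.
      by apply: (sub X) => //; have [[_ XD _] _] := FP _ FX; exact: XD.
    by right; exact: KD.
  - move=> t x t0 Ux; have [[X FX [Xx _]]|[Kx _]] := ex2 _ _ Ux Ux.
      by apply: (sub X) => //; have [[_ _ XZ] _] := FP _ FX; exact: XZ.
    by right; exact: KZ.
  - move=> Ue; have [[X FX [Xe _]]|[//]] := ex2 _ _ Ue Ue.
    by have [_] := FP _ FX; exact.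
pose M := A `|` K.
have max N : convex_cone N -> M `<=` N -> ~ N e -> N `<=` M.
  move=> cN MN Ne; apply: contrapT => NM; apply: (Amax N).
    split; first by move=> x Ax; apply: MN; left.
    by move=> NA; apply: NM => x Nx; left; exact: NA.
  have -> : P N = (convex_cone N /\ ~ N e); last by [].
  rewrite /P (_ : N `|` K = N) // predeqE => x; split; last by left.
  by case=> // Kx; apply: MN; right.
have [M0 MD MZ] := cA.
have ray v : ~ M v -> exists m s, [/\ M m, 0 <= s & e = m + s%:C%C *: v].
  move=> Mv; apply: contrapT => no; apply: Mv.
  pose N := [set x | exists m s, [/\ M m, 0 <= s & x = m + s%:C%C *: v]].
  apply: (max N); last by exists 0, 1; split; rewrite ?ler01 // add0r scale1r.
  - split; first by exists 0, 0; rewrite scale0r addr0.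
    + move=> _ _ [m [s [Mm s0 ->]]] [m' [s' [Mm' s0' ->]]].
      exists (m + m'), (s + s'); split; [exact: (MD) | exact: addr_ge0 |].
      by lmod.
    + move=> t _ t0 [m [s [Mm s0 ->]]].
      exists (t%:C%C *: m), (t * s); split; [exact: (MZ) | exact: mulr_ge0 |].
      by lmod.
  - by move=> x Mx; exists x, 0; split => //; rewrite scale0r addr0.
  - exact: no.
exists M; split => //; first by move=> x; right.
move=> v; apply: contrapT => /not_orP[/ray[m [s [Mm s0 es]]] /ray[m' [t [Mm' t0 et]]]].
have st : 0 < s + t.
  rewrite lt_def addr_ge0 // andbT; apply: contra_notN Ae => /eqP st.
  have s00 : s = 0 by lra.
  by rewrite es s00 scale0r addr0.
apply: Ae; have -> : e = ((s + t)^-1)%:C%C *: (t%:C%C *: m + s%:C%C *: m').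
  have -> : t%:C%C *: m + s%:C%C *: m' = (s + t)%:C%C *: e.
    rewrite rmorphD /= scalerDl {1}et {1}es; lmod.
  by rewrite scalerA -rmorphM /= mulVf ?scale1r // gt_eqF.
by apply: (MZ); [rewrite invr_ge0 ltW | apply: (MD); exact: (MZ)].
Qed.

(** The functional is read off from the half-space [M] of [maximal_cone]:
    [phi v] is the cut of the reals [t] for which [t u - v] lies in [M]. *)
Theorem cone_separation K u e : convex_cone K -> K u ->
  (forall v, exists t, K (t%:C%C *: u - v)) -> ~ K e ->
  exists phi : V -> R, [/\ forall x y, phi (x + y) = phi x + phi y,
    forall t x, phi (t%:C%C *: x) = t * phi x, forall x, K x -> 0 <= phi x,
    phi u = 1 & phi e <= 0].
Proof.
move=> cK Ku unit Ke; have [M [cM KM Me tot]] := maximal_cone cK Ke.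
have [M0 MD MZ] := cM.
have Mu t : 0 <= t -> M (t%:C%C *: u) by move=> t0; apply: (MZ) => //; exact: KM.
(* A negative multiple of the order unit in [M] would force [e] into [M]. *)
have neg t : M (t%:C%C *: u) -> 0 <= t.
  move=> Mt; rewrite leNgt; apply/negP => t0; apply: Me.
  have [s /KM Ms] := unit (- e).
  pose r := Num.max s 0.
  have -> : e = (s%:C%C *: u - - e) + ((r - s)%:C%C *: u)
     + ((- r / t)%:C%C *: (t%:C%C *: u)).
    rewrite scalerA -rmorphM /= divfK ?lt_eqF // rmorphB rmorphN /=; lmod.
  apply: (MD); first by apply: (MD) => //; apply: Mu; rewrite subr_ge0 le_max lexx.
  apply: (MZ) => //; rewrite mulNr -mulrN -invrN mulr_ge0 //.
    by rewrite le_max lexx orbT.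
  by rewrite invr_ge0 oppr_ge0 ltW.
pose S v := [set t | M (t%:C%C *: u - v)].
pose phi v := inf (S v).
have Sinf v : has_inf (S v).
  split; first by have [t /KM] := unit v; exists t.
  have [s /KM Ms] := unit (- v); exists (- s) => t Mt.
  rewrite -subr_ge0 opprK; apply: neg.
  rewrite (_ : _ *: u = (t%:C%C *: u - v) + (s%:C%C *: u - - v)); first exact: (MD).
  by lmod.
have up v t : M (t%:C%C *: u - v) -> phi v <= t.
  by move=> Mt; apply: ge_inf => //; exact: (Sinf v).2.
have low v t : M (v - t%:C%C *: u) -> t <= phi v.
  move=> Mt; apply: lb_le_inf; first exact: (Sinf v).1.
  move=> s Ms; rewrite -subr_ge0; apply: neg.
  rewrite (_ : _ *: u = (v - t%:C%C *: u) + (s%:C%C *: u - v)); first exact: (MD).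
  by lmod.
have up' v t : phi v < t -> M (t%:C%C *: u - v).
  move=> vt; have [|s Ss st] := @inf_adherent _ (S v) (t - phi v) _ (Sinf v).
    by rewrite subr_gt0.
  rewrite (_ : _ - v = (s%:C%C *: u - v) + ((t - s)%:C%C *: u)); last first.
    by lmod.
  by apply: (MD) => //; apply: Mu; move: st; rewrite -/(phi v); lra.
have low' v t : t < phi v -> M (v - t%:C%C *: u).
  move=> tv; have [Mt|] := tot (t%:C%C *: u - v); last by rewrite opprB.
  by have := up _ _ Mt; rewrite leNgt tv.
have phiD x y : phi (x + y) = phi x + phi y.
  apply/eqP; rewrite eq_le; apply/andP; split.
    apply: (@le_eps _ _ _ 2) => d d0; apply: up.
    rewrite (_ : _ - _ = ((phi x + d)%:C%C *: u - x) + ((phi y + d)%:C%C *: u - y)).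
      by apply: (MD); apply: up'; rewrite ltrDl.
    by lmod.
  apply: (@le_eps _ _ _ 2) => d d0; rewrite -lerBlDr; apply: low.
  rewrite (_ : _ - _ = (x - (phi x - d)%:C%C *: u) + (y - (phi y - d)%:C%C *: u)).
    by apply: (MD); apply: low'; rewrite ltrBlDr ltrDl.
  by lmod.
have phi0 : phi 0 = 0 by have := phiD 0 0; rewrite addr0; lra.
have phiN x : phi (- x) = - phi x.
  by have := phiD x (- x); rewrite subrr phi0; lra.
have phiZ t x : 0 < t -> phi (t%:C%C *: x) = t * phi x.
  move=> t0; apply/eqP; rewrite eq_le; apply/andP; split.
    apply: (@le_eps _ _ _ t) => d d0; apply: up.
    rewrite (_ : _ - _ = t%:C%C *: ((phi x + d)%:C%C *: u - x)).
      by apply: (MZ); [exact: ltW | apply: up'; rewrite ltrDl].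
    by lmod.
  apply: (@le_eps _ _ _ t) => d d0; rewrite -lerBlDr; apply: low.
  rewrite (_ : _ - _ = t%:C%C *: (x - (phi x - d)%:C%C *: u)).
    by apply: (MZ); [exact: ltW | apply: low'; rewrite ltrBlDr ltrDl].
  by lmod.
exists phi; split => //.
- move=> t x; have [t0|t0|->] := ltgtP t 0; last by rewrite scale0r mul0r.
    rewrite -[t]opprK rmorphN /= scaleNr phiN phiZ ?oppr_gt0 //.
    by rewrite -mulNr opprK.
  exact: phiZ.
- by move=> x /KM Mx; apply: low; rewrite scale0r subr0.
- by apply/eqP; rewrite eq_le up ?low // scale1r subrr.
- apply: up; rewrite scale0r sub0r.
  by have [] := tot e.
Qed.

End Separation.

(** * Positive functionals *)

(** The real part of a positive linear functional; [cfun] below recovers the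
    complex functional. *)
Record posfun (R : realType) (A : cstarType R) := PosFun {
  pf :> A -> R;
  pfD : forall x y, pf (x + y) = pf x + pf y;
  pfZ : forall t x, pf (t%:C%C *: x) = t * pf x;
  pf_star : forall x, pf (star x) = pf x;
  pf_ge0 : forall x, pcone x -> 0 <= pf x
}.

Section PositiveFunctionals.
Variables (R : realType) (A : cstarType R).
Implicit Types (phi : posfun A) (x y : A) (t : R).

Local Ltac lmod := lmod_over (R[i] : comNzRingType).

Lemma pf0 phi : phi 0 = 0.
Proof. by have := pfD phi 0 0; rewrite addr0; lra. Qed.

Lemma pfN phi x : phi (- x) = - phi x.
Proof. by have := pfD phi x (- x); rewrite subrr pf0; lra. Qed.

Lemma pfB phi x y : phi (x - y) = phi x - phi y.
Proof. by rewrite pfD pfN. Qed.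

Lemma pf_starM_ge0 phi x : 0 <= phi (star x * x).
Proof. exact/pf_ge0/pcone_starM. Qed.

Lemma pf1_ge0 phi : 0 <= phi 1.
Proof. by rewrite -[1]mulr1 -{1}star1 pf_starM_ge0. Qed.

Lemma pf_le_sa phi x : selfadjoint x -> phi x <= phi 1 * cnorm x.
Proof.
move=> xs; have := pf_ge0 phi (pcone_cnorm xs).
by rewrite pfB pfZ subr_ge0 mulrC.
Qed.

Lemma pf_le phi x : `|phi x| <= phi 1 * cnorm x.
Proof.
have h y : phi y <= phi 1 * cnorm y.
  have ys : selfadjoint (y + star y) by rewrite /selfadjoint starD starK addrC.
  have := pf_le_sa phi ys; rewrite pfD pf_star.
  have := ler_wpM2l (pf1_ge0 phi) (ler_cnormD y (star y)).
  rewrite cnorm_star; lra.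
by rewrite ler_norml h andbT lerNl -pfN -cnormN.
Qed.

(** Elements [x] with [x + star x = 0] and their opposites have nonnegative value,
    so the functional vanishes on them and is determined by self-adjoint parts. *)
Lemma posfun_of (phi : A -> R) : (forall x y, phi (x + y) = phi x + phi y) ->
  (forall t x, phi (t%:C%C *: x) = t * phi x) ->
  (forall x, pcone (x + star x) -> 0 <= phi x) ->
  {psi : posfun A | forall x, psi x = phi x}.
Proof.
move=> phiD phiZ phi_ge0.
have phiN x : phi (- x) = - phi x.
  by rewrite -scaleN1r -[X in X *: _](rmorphN1 (real_complex R)) phiZ mulN1r.
have phi_star x : phi (star x) = phi x.
  have h1 : 0 <= phi (x - star x).
    by apply: phi_ge0; rewrite starB starK addrA subrK subrr; exact: pcone0.
  have h2 : 0 <= phi (star x - x).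
    by apply: phi_ge0; rewrite starB starK addrA subrK subrr; exact: pcone0.
  by move: h1 h2; rewrite !phiD !phiN; lra.
have phi_pos x : pcone x -> 0 <= phi x.
  by move=> xP; apply: phi_ge0; rewrite xP.1; exact: pconeD.
by exists (PosFun phiD phiZ phi_star phi_pos).
Qed.

Lemma state_separation x : selfadjoint x -> ~ pcone x ->
  exists phi : posfun A, phi 1 = 1 /\ phi x <= 0.
Proof.
move=> xs xN; pose K := [set y : A | pcone (y + star y)].
have [||||phi [phiD phiZ phiK phi1 phix]] := @cone_separation R A K 1 x.
- split; first by rewrite /K /= star0 addr0; exact: pcone0.
    move=> y z yK zK; rewrite /K /= starD.
    by rewrite addrACA; exact: pconeD.
  by move=> t y t0 yK; rewrite /K /= starZR -scalerDr; exact: pconeZ.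
- by rewrite /K /= star1 -[1]scale1r; apply: pconeD; exact: (@pcone_scalar _ A 1).
- move=> v; exists (cnorm (v + star v)); rewrite /K /= starB starZR star1.
  set n := cnorm _.
  have vs : selfadjoint (v + star v) by rewrite /selfadjoint starD starK addrC.
  have -> : n%:C%C *: 1 - v + (n%:C%C *: 1 - star v) =
      (n%:C%C *: 1 - (v + star v)) + n%:C%C *: 1 by lmod.
  by apply: pconeD; [exact: pcone_cnorm | exact/pcone_scalar/cnorm_ge0].
- move=> xK; apply: xN; rewrite (_ : x = (2^-1)%:C%C *: (x + star x)).
    by apply: pconeZ => //; rewrite invr_ge0.
  have -> : x + star x = (2%:C)%C *: x by rewrite xs; lmod.
  by rewrite scalerA -rmorphM /= mulVf // scale1r.
have [psi psiE] := posfun_of phiD phiZ phiK.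
by exists psi; rewrite !psiE.
Qed.

(** Otherwise [|x|^2 / 2 - x' x] would be positive, where [x'] is the adjoint of
    [x], contradicting [|x' x| = |x|^2].  The factor [2] leaves room for the strict
    inequality. *)
Lemma state_detects x : exists phi : posfun A,
  phi 1 = 1 /\ cnorm x ^+ 2 <= 2 * phi (star x * x).
Proof.
have [->|x0] := eqVneq x 0.
  have nP : ~ pcone (- 1 : A).
    rewrite -scaleN1r -[X in X *: _](rmorphN1 (real_complex R)).
    by move/pcone_scalar_ge0; lra.
  have [phi [phi1 _]] := state_separation (selfadjointN (selfadjoint1 A)) nP.
  by exists phi; rewrite phi1 cnorm0 mulr0 pf0; split=> //; rewrite expr0n mulr0.
pose c := cnorm x ^+ 2 / 2.
have c0 : 0 < c by rewrite divr_gt0 // exprn_gt0 // lt_def cnorm_eq0 x0 cnorm_ge0.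
have xs : selfadjoint (c%:C%C *: 1 - star x * x).
  by apply: selfadjointB; [exact: scalar_sa | exact: selfadjoint_starM].
have [h|phi [phi1 phix]] := state_separation xs.
  have : cnorm (star x * x) <= c.
    apply: pcone_cnorm_le => //; first exact: selfadjoint_starM.
    by apply: pconeD; [exact/pcone_scalar/ltW | exact: pcone_starM].
  by rewrite cnorm_starM /c; move: c0; rewrite /c; lra.
exists phi; split=> //; move: phix; rewrite pfB pfZ phi1 /c; lra.
Qed.

End PositiveFunctionals.

Section PosfunSeries.
Variables (R : realType) (A : cstarType R) (phi : nat -> posfun A).
Hypothesis phi1 : forall n, phi n 1 = 1.

Let w n : R := n.+1%:R^-1 - n.+2%:R^-1.

Let w_gt0 n : 0 < w n.
Proof. by rewrite subr_gt0 ltf_pV2 ?posrE ?ltr0n // ltr_nat. Qed.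

Let psum n x := \sum_(k < n) w k * phi k x.

Let psum_lim x : exists l, forall n, `|psum n x - l| <= cnorm x * n.+1%:R^-1.
Proof.
apply: real_limit; first exact: cnorm_ge0.
have mono m n : (m <= n)%N ->
    `|psum n x - psum m x| <= cnorm x * (m.+1%:R^-1 - n.+1%:R^-1).
  move/subnKC <-; elim: (n - m)%N => [|k IH].
    by rewrite addn0 !subrr normr0 mulr0.
  rewrite addnS /psum big_ord_recr /= -/(psum _ _).
  rewrite addrAC (le_trans (ler_normD _ _)) // normrM gtr0_norm //.
  have := ler_wpM2l (ltW (w_gt0 (m + k))) (pf_le (phi (m + k)%N) x).
  move: IH; rewrite phi1 mul1r /w -!/(psum _ _).
  set a := (m.+1)%:R^-1; set b := ((m + k).+1)%:R^-1; set c := ((m + k).+2)%:R^-1.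
  move: (`|_ - _|) => p; move: (_ * `|_|) => q; lra.
move=> m n; have c0 := cnorm_ge0 x.
have pos k : 0 <= k.+1%:R^-1 :> R by rewrite invr_ge0.
have [mn|/ltnW nm] := leqP m n.
  rewrite distrC (le_trans (mono _ _ mn)) // ler_wpM2l // lerD2l.
  by rewrite (@le_trans _ _ 0) // oppr_le0.
rewrite (le_trans (mono _ _ nm)) // ler_wpM2l // addrC lerD2r.
by rewrite (@le_trans _ _ 0) // oppr_le0.
Qed.

(** A weighted sum of the [phi_n].  The telescoping weights
    [1 / (n + 1) - 1 / (n + 2)] make the tails of the series equal to
    [1 / (n + 1)], the rate of [real_limit]. *)
Lemma posfun_series : exists tau : posfun A,
  forall x, pcone x -> tau x = 0 -> forall n, phi n x = 0.
Proof.
have [tau htau] := choice psum_lim.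
have lim_eq (a K : R) : (forall n, `|a| <= K * n.+1%:R^-1) -> a = 0.
  move=> h; apply/eqP; rewrite -normr_eq0 eq_le normr_ge0 andbT.
  apply: (@le_eps _ _ _ `|K|) => e e0; have [n /(_ n (leqnn n)) ne] := inv_small e0.
  rewrite add0r (le_trans (h n)) // (@le_trans _ _ (`|K| * n.+1%:R^-1)) //.
    by rewrite ler_wpM2r ?invr_ge0 // ler_norm.
  by rewrite ler_wpM2l // ltW.
have psumD n x y : psum n (x + y) = psum n x + psum n y.
  by rewrite /psum -big_split; apply: eq_bigr => k _; rewrite pfD mulrDr.
have psumZ n t x : psum n (t%:C%C *: x) = t * psum n x.
  by rewrite /psum mulr_sumr; apply: eq_bigr => k _; rewrite pfZ mulrCA.
have tauD x y : tau (x + y) = tau x + tau y.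
  apply/eqP; rewrite -subr_eq0; apply/eqP.
  apply: (@lim_eq _ (cnorm (x + y) + cnorm x + cnorm y)) => n.
  have -> : tau (x + y) - (tau x + tau y) = - (psum n (x + y) - tau (x + y))
     + ((psum n x - tau x) + (psum n y - tau y)) by rewrite psumD; ring.
  rewrite !mulrDl -[leRHS]addrA (le_trans (ler_normD _ _)) // normrN lerD //.
  by rewrite (le_trans (ler_normD _ _)) // lerD.
have tauZ t x : tau (t%:C%C *: x) = t * tau x.
  apply/eqP; rewrite -subr_eq0; apply/eqP.
  apply: (@lim_eq _ (cnorm (t%:C%C *: x) + `|t| * cnorm x)) => n.
  have -> : tau (t%:C%C *: x) - t * tau x = - (psum n (t%:C%C *: x) - tau (t%:C%C *: x))
     + t * (psum n x - tau x) by rewrite psumZ; ring.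
  rewrite mulrDl (le_trans (ler_normD _ _)) // normrN lerD //.
  by rewrite normrM -mulrA ler_wpM2l.
have tau_star x : tau (star x) = tau x.
  apply/eqP; rewrite -subr_eq0; apply/eqP.
  apply: (@lim_eq _ (cnorm (star x) + cnorm x)) => n.
  have psum_star : psum n (star x) = psum n x.
    by apply: eq_bigr => k _; rewrite pf_star.
  have -> : tau (star x) - tau x =
      - (psum n (star x) - tau (star x)) + (psum n x - tau x).
    by rewrite psum_star; ring.
  by rewrite mulrDl (le_trans (ler_normD _ _)) // normrN lerD.
have low k x : pcone x -> w k * phi k x <= tau x.
  move=> xP; apply: (@le_eps _ _ _ (cnorm x)) => e e0.
  have [n0 hn] := inv_small e0; pose n := (maxn n0 k.+1).
  have h1 : w k * phi k x <= psum n x.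
    have kn : (k < n)%N by rewrite leq_max ltnSn orbT.
    rewrite /psum (bigD1 (Ordinal kn)) //= lerDl sumr_ge0 // => j _.
    by rewrite mulr_ge0 ?pf_ge0 // ltW.
  have h2 : cnorm x * n.+1%:R^-1 <= cnorm x * e.
    by rewrite ler_wpM2l ?cnorm_ge0 // ltW // hn // leq_maxl.
  have := le_trans (htau x n) h2; rewrite ler_norml => /andP[_]; move: h1; lra.
have tau_ge0 x : pcone x -> 0 <= tau x.
  by move=> xP; apply: le_trans (low 0%N x xP); rewrite mulr_ge0 ?pf_ge0 // ltW.
exists (PosFun tauD tauZ tau_star tau_ge0) => x xP /= tau0 n.
apply/eqP; rewrite eq_le pf_ge0 // andbT -(pmulr_rle0 _ (w_gt0 n)) -tau0.
exact: low.
Qed.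

End PosfunSeries.

Section FaithfulFunctional.
Variables (R : realType) (A : cstarType R) (B : cstarSubalg A).

Local Ltac lmod := lmod_over (R[i] : comNzRingType).

Lemma separable_sequence (C : cstarType R) : cstar_separable C ->
  exists e : nat -> C, forall x (r : R), 0 < r -> exists n, cnorm (x - e n) < r.
Proof.
move=> [D /countable_injP[c cI] Dd].
exists (fun n => xget 0 [set d | D d /\ c d = n]) => x r /(Dd x)[d Dx dx].
exists (c d); case: xgetP => [y _ [Dy cy]|/(_ d)[]//].
by rewrite (_ : y = d) //; apply: cI; rewrite ?inE.
Qed.

(** Sum functionals that detect the elements of a dense sequence [e_n].  If
    [tau(b' b) = 0] and [c = e_n] is close to [b], then
    [c' c <= 2 b' b + 2 (c - b)' (c - b)] shows that [c] is small, and so is [b]. *)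
Lemma faithful_posfun : cstar_separable (subalg B) ->
  exists tau : posfun A, forall b : subalg B, tau (star (val b) * val b) = 0 -> b = 0.
Proof.
move=> /separable_sequence[e eD].
have [phi hphi] := choice (fun n => state_detects (val (e n))).
have [tau htau] := posfun_series (fun n => (hphi n).1).
exists tau => b b0; apply: cnorm0_eq0; apply/eqP; rewrite eq_le cnorm_ge0 andbT.
apply: (@le_eps _ _ _ 3) => r r0; have [n bn] := eD b r r0.
have z := htau _ (pcone_starM (val b)) b0 n.
have [p1 hn] := hphi n; set c := val (e n) in hn.
have bc : cnorm (c - val b) <= r by rewrite cnormB ltW.
have : 0 <= phi n (star (c - val b - val b) * (c - val b - val b)).
  exact: pf_starM_ge0.
have -> : star (c - val b - val b) * (c - val b - val b) =
   (star (val b) * val b) + (star (val b) * val b) + (star (c - val b) * (c - val b))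
   + (star (c - val b) * (c - val b)) - star c * c.
  by rewrite !starB !(mulrDl, mulrDr, mulrN, mulNr, opprK); lmod.
rewrite pfB !pfD z.
have := pf_le (phi n) (star (c - val b) * (c - val b)).
rewrite p1 mul1r cnorm_starM => /(le_trans (ler_norm _)).
move: (phi n _) => p h1 h2.
have h3 : cnorm (c - val b) ^+ 2 <= r ^+ 2.
  by rewrite ler_pXn2r ?nnegrE ?cnorm_ge0 // ltW.
have h4 : cnorm c <= 2 * r.
  rewrite -(@ler_pXn2r _ 2) ?nnegrE ?cnorm_ge0 ?mulr_ge0 ?(ltW r0) // exprMn.
  move: h1 h2 h3 hn; move: (phi n _) => q; lra.
have := ler_cnormB c (c - val b); rewrite subKr.
by change (cnorm b) with (cnorm (val b)); lra.
Qed.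

End FaithfulFunctional.

(** * The GNS representation *)

Section ComplexFunctional.
Variables (R : realType) (A : cstarType R) (phi : posfun A).
Implicit Types (x y z c : A).

Local Ltac lmod := lmod_over (R[i] : comNzRingType).

(** The complex-linear functional with real part [phi]. *)
Definition cfun x : R[i] := Complex (phi x) (- phi ('i *: x)).

Lemma cfunD x y : cfun (x + y) = cfun x + cfun y.
Proof. by rewrite /cfun scalerDr !pfD opprD. Qed.

Lemma cfunZ k x : cfun (k *: x) = k * cfun x.
Proof.
have E (a b : R) : Complex a b = a%:C%C + b%:C%C * 'i.
  by rewrite [LHS]complexE /= mulrC complexiE.
case: k => a b; rewrite /cfun [Complex a b]E !(scalerDl, scalerDr) !scalerA.
rewrite (_ : 'i * (b%:C%C * 'i) = (- b)%:C%C); last first.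
  by rewrite mulrCA mulCii mulrN1 rmorphN.
rewrite ['i * a%:C%C]mulrC -!scalerA !pfD !pfZ !E.
rewrite !rmorphN !rmorphD !rmorphM /= !rmorphN /=.
have i2 : 'i * 'i = -1 :> R[i] := mulCii _.
set p := (phi x)%:C%C; set q := (phi _)%:C%C; set a' := a%:C%C; set b' := b%:C%C.
have -> : (a' + b' * 'i) * (p + - q * 'i) =
  a' * p - a' * q * 'i + b' * p * 'i - b' * q * ('i * 'i) by ring.
by rewrite i2; ring.
Qed.

Lemma cfunN x : cfun (- x) = - cfun x.
Proof. by rewrite -scaleN1r cfunZ mulN1r. Qed.

Lemma cfun_star x : cfun (star x) = Num.conj (cfun x).
Proof.
rewrite /cfun /= pf_star; congr Complex.
have -> : 'i *: star x = - star ('i *: x) by rewrite starZ conjCi scaleNr opprK.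
by rewrite pfN pf_star.
Qed.

Lemma cfun_ge0 x : pcone x -> 0 <= cfun x.
Proof.
move=> xP; rewrite lecE /= pf_ge0 // andbT oppr_eq0.
have := pf_star phi ('i *: x); rewrite starZ conjCi xP.1 scaleNr pfN.
by move=> h; apply/eqP; lra.
Qed.

Fact sq_linear k x y z : cfun (star z * (k *: x + y)) =
  k * cfun (star z * x) + cfun (star z * y).
Proof. by rewrite mulrDr -scalerAr cfunD cfunZ. Qed.

Fact sq_herm x y : cfun (star x * y) = Num.conj (cfun (star y * x)).
Proof. by rewrite -cfun_star starM starK. Qed.

Fact sq_ge0 x : 0 <= cfun (star x * x).
Proof. exact/cfun_ge0/pcone_starM. Qed.

Definition sq_form : semi_ip A := @SemiIp _ _ (fun x y => cfun (star y * x))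
  sq_linear sq_herm sq_ge0.

Lemma pcone_conj x c : pcone c -> pcone (star x * c * x).
Proof.
move=> /pcone_sqrt[u [us <- _ _]].
rewrite (_ : _ * x = star (u * x) * (u * x)); first exact: pcone_starM.
by rewrite starM us !mulrA.
Qed.

(** The inequality [x' c' c x <= |c|^2 x' x]. *)
Lemma seminorm_mul c x : seminorm sq_form (c * x) <= cnorm c * seminorm sq_form x.
Proof.
rewrite -(@ler_pXn2r _ 2) ?nnegrE ?mulr_ge0 ?cnorm_ge0 ?seminorm_ge0 //.
rewrite exprMn !sqr_seminorm /= -cnorm_starM starM.
have := pf_ge0 phi (pcone_conj x (pcone_cnorm (selfadjoint_starM c))).
rewrite mulrBr mulrBl pfB -scalerAr mulr1 -scalerAl pfZ subr_ge0.
by rewrite !mulrA.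
Qed.

End ComplexFunctional.

Section GNS.
Variables (R : realType) (A : cstarType R) (B : cstarSubalg A) (omega : posfun A).
Implicit Types (x y b c : subalg B).

Definition gns_form : semi_ip (subalg B) := @SemiIp _ _
  (fun x y => sq_form omega (val x) (val y))
  (fun k x y z => ip_linear (sq_form omega) k (val x) (val y) (val z))
  (fun x y => ip_herm (sq_form omega) (val x) (val y))
  (fun x => ip_ge0 (sq_form omega) (val x)).

Definition gns := completion gns_form.
Implicit Types (u v : gns).

Lemma gns_seminorm_mul b x :
  seminorm gns_form (b * x) <= cnorm b * seminorm gns_form x.
Proof. exact: (seminorm_mul omega (val b) (val x)). Qed.

Lemma gns_rep_bound b u :
  fbound gns_form (fun y => cval u (star b * y)) (cnorm b * cnrm u).
Proof.
move=> y; rewrite (le_trans (cval_le _ _)) // mulrAC [leRHS]mulrC.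
by rewrite ler_wpM2l ?cnrm_ge0 // -(cnorm_star b) gns_seminorm_mul.
Qed.

Fact gns_rep_subproof b u :
  (fun y => cval u (star b * y)) \in bounded_antilinear gns_form.
Proof.
apply/asboolP; split; first by move=> k x y; rewrite mulrDr -scalerAr cval_antilinear.
exists (cnorm b * cnrm u); last exact: gns_rep_bound.
by rewrite mulr_ge0 ?cnorm_ge0 ?cnrm_ge0.
Qed.

(** On antilinear functionals, [b] acts by translating the argument by its adjoint:
    on the image of [B] this is left multiplication ([gns_rep_embed]). *)
Definition gns_rep b u : gns := Completion (gns_rep_subproof b u).

Lemma gns_rep_opbound b : opbound (gns_rep b) (cnorm b).
Proof.
split; first by move=> k u v; exact: completionP.
move=> u; apply: cnrm_le; last exact: gns_rep_bound.
by rewrite mulr_ge0 ?cnorm_ge0 ?cnrm_ge0.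
Qed.

Lemma gns_rep_embed b x : gns_rep b (embed gns_form x) = embed gns_form (b * x).
Proof.
by apply: completionP => y /=; rewrite !starM !starK mulrA.
Qed.

Lemma gns_star_rep : star_rep (H := gns) gns_rep.
Proof.
split.
- by move=> b; exact: opbound_bounded_op (gns_rep_opbound b).
- move=> k b c; apply/funext => u; apply: completionP => y.
  change (cval u (star (k *: b + c) * y) =
    k * cval u (star b * y) + cval u (star c * y)).
  by rewrite starD starZ mulrDl -scalerAl cval_antilinear conjCK.
- by move=> b c; apply/funext => u; apply: completionP => y /=; rewrite starM mulrA.
- move=> b u v; apply: (opbound_adjoint (gns_rep_opbound b) (gns_rep_opbound (star b))).
  by move=> x y; rewrite !gns_rep_embed !cdot_embedr !embedE /= !starM starK mulrA.
Qed.

End GNS.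

Section GNSOperators.
Variables (R : realType) (A : cstarType R) (B : cstarSubalg A) (omega : posfun A).
Implicit Types (x y b c : subalg B) (phi : posfun A).

Local Notation H := (gns B omega).
Local Notation emb := (embed (gns_form B omega)).
Implicit Types (u v : H).

Lemma opboundB (S T : H -> H) (M N : R) : opbound S M -> opbound T N ->
  opbound (fun u => S u - T u) (M + N).
Proof.
move=> [Sl SM] [Tl TN]; split.
  move=> k u v; rewrite Sl Tl scalerBr opprD !addrA; congr (_ + _).
  by rewrite addrAC.
move=> u; rewrite (le_trans (seminormD _ _ _)) // seminormN mulrDl.
by rewrite lerD // ?SM ?TN.
Qed.

Lemma opboundZ (S : H -> H) (M : R) k : opbound S M ->
  opbound (fun u => k *: S u) (cabs k * M).
Proof.
move=> [Sl SM]; split.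
  by move=> l u v; rewrite Sl scalerDr !scalerA mulrC.
by move=> u; rewrite /cnrm seminormZ -mulrA ler_wpM2l ?cabs_ge0 //; exact: SM.
Qed.

Lemma opbound_comp (S T : H -> H) (M N : R) : 0 <= M ->
  opbound S M -> opbound T N -> opbound (S \o T) (M * N).
Proof.
move=> M0 [Sl SM] [Tl TN]; split; first by move=> k u v; rewrite /= Tl Sl.
by move=> u; rewrite (le_trans (SM _)) // -mulrA ler_wpM2l.
Qed.

Lemma opbound_id : opbound (fun u => u) 1.
Proof. by split => // u; rewrite mul1r. Qed.

(** The element [c] of [A] acts on the larger space of the representation of [A];
    its matrix coefficients at vectors from [B] define the compression [T]. *)
Lemma compression (c : A) : exists T : H -> H, opbound T (cnorm c) /\
  forall x y, cval (T (emb x)) y = cfun omega (star (val y) * (c * val x)).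
Proof.
have [||||T TM TE] := @form_operator R (subalg B) (gns_form B omega)
  (fun x y => cfun omega (star (val y) * (c * val x))) (cnorm c).
- exact: cnorm_ge0.
- move=> k x y z.
  have -> : val (k *: x + y) = k *: val x + val y by [].
  by rewrite mulrDr -scalerAr sq_linear.
- move=> k x y z; rewrite -cfunZ -cfunD /= starD starZ mulrDl.
  by rewrite -scalerAl.
- move=> x y; rewrite (le_trans (cabs_ip (sq_form omega) (c * val x) (val y))) //.
  by rewrite mulrA ler_wpM2r ?seminorm_ge0 // seminorm_mul.
by exists T.
Qed.

(** The form [phi (y' x)] is bounded by the one of [omega], so it comes from an
    operator; it commutes with the representation because
    [phi (y' (b x)) = phi ((b' y)' x)]. *)
Lemma radon_nikodym phi : (forall z, pcone z -> phi z <= omega z) ->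
  exists h : H -> H, [/\ opbound h 1,
    forall x y, cval (h (emb x)) y = cfun phi (star (val y) * val x),
    forall u v, cdot (h u) v = cdot u (h v),
    forall u, 0 <= cdot (h u) u <= cdot u u
  & forall b, h \o gns_rep b = gns_rep b \o h].
Proof.
move=> dom.
have sle x : seminorm (sq_form phi) (val x) <= seminorm (gns_form B omega) x.
  rewrite /seminorm ler_sqrt; last exact: Re_ip_ge0.
  exact/dom/pcone_starM.
have [||||h hM hE] := @form_operator R (subalg B) (gns_form B omega)
  (fun x y => cfun phi (star (val y) * val x)) 1.
- by [].
- by move=> k x y z; rewrite sq_linear.
- by move=> k x y z; rewrite -cfunZ -cfunD /= starD starZ mulrDl -scalerAl.
- move=> x y; rewrite mul1r (le_trans (cabs_ip (sq_form phi) (val x) (val y))) //.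
  by rewrite ler_pM ?seminorm_ge0.
exists h; split => //.
- apply: (opbound_adjoint hM hM) => x y.
  by rewrite cdot_embedr cdot_embedl !hE -sq_herm.
- move=> u; apply/andP; split.
    by apply: (opbound_pos hM) => x; rewrite cdot_embedr hE; exact: sq_ge0.
  rewrite -subr_ge0 -cdotBl; apply: (opbound_pos (opboundB opbound_id hM)) => x.
  rewrite cdot_embedr cvalD cvalN hE embedE subr_ge0 /=.
  rewrite (ge0_RRe (sq_ge0 phi _)) (ge0_RRe (sq_ge0 omega _)) lecR.
  exact/dom/pcone_starM.
- move=> b; apply/funext; apply: (opbound_eq
    (opbound_comp ler01 hM (gns_rep_opbound omega b))
    (opbound_comp (cnorm_ge0 b) (gns_rep_opbound omega b) hM)) => x /=.
  rewrite gns_rep_embed; apply: completionP => y /=.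
  by rewrite !hE /= starM starK mulrA.
Qed.

End GNSOperators.

(** * Interpolation in the subalgebra *)

Section Interpolation.
Variables (R : realType) (A : cstarType R) (B : cstarSubalg A).
Hypothesis separable_B : cstar_separable (subalg B).
Hypothesis wep_B : weak_expectation_property (subalg B).
Variables (a : A) (I : finType) (s : I -> R) (d : I -> subalg B).
Hypothesis sda : forall i, cstar_pos ((s i)%:C%C *: (val (d i) - a)).

Local Ltac lmod := lmod_over (R[i] : comNzRingType).

(** The one place where the weak expectation enters.  For an [x] in [B] with
    [s_i (d_i - x) >= 0] the sum would be [sum_i phi_i(s_i (d_i - x))].  Such an [x]
    exists in the bicommutant of [B]: the expectation of the compression of [a].
    The [phi_i] make sense there through their Radon-Nikodym derivatives. *)
Lemma balanced_posfun_ge0 (phi : I -> posfun A) :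
  (forall b : subalg B, \sum_i s i * phi i (val b) = 0) ->
  0 <= \sum_i s i * phi i (val (d i)).
Proof.
move=> bal; have [tau tau_faithful] := faithful_posfun separable_B.
(* [omega] dominates every [phi i], and [tau] makes it faithful on [B]. *)
pose om x := \sum_i phi i x + tau x.
have omD x y : om (x + y) = om x + om y.
  rewrite /om pfD (eq_bigr (fun i => phi i x + phi i y)); last first.
    by move=> i _; rewrite pfD.
  by rewrite big_split addrACA.
have omZ t x : om (t%:C%C *: x) = t * om x.
  rewrite /om pfZ mulrDr mulr_sumr; congr (_ + _).
  by apply: eq_bigr => i _; rewrite pfZ.
have om_star x : om (star x) = om x.
  by rewrite /om pf_star; congr (_ + _); apply: eq_bigr => i _; rewrite pf_star.
have om_ge0 x : pcone x -> 0 <= om x.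
  by move=> xP; rewrite addr_ge0 ?pf_ge0 // sumr_ge0 // => i _; rewrite pf_ge0.
pose omega := PosFun omD omZ om_star om_ge0.
have dom i z : pcone z -> phi i z <= omega z.
  move=> zP; rewrite /= /om (bigD1 i) //= -addrA lerDl addr_ge0 ?pf_ge0 //.
  by rewrite sumr_ge0 // => j _; rewrite pf_ge0.
have pi_inj : injective (gns_rep (B := B) (omega := omega)).
  move=> b c bc; apply/eqP; rewrite -subr_eq0; apply/eqP/tau_faithful.
  have : embed (gns_form B omega) (b - c) = 0.
    have := congr1 (fun T => T (embed (gns_form B omega) 1)) bc.
    rewrite !gns_rep_embed !mulr1 => e; apply: completionP => y.
    rewrite cval0 embedE ipBl.
    by have := congr1 (fun u => cval u y) e; rewrite !embedE => ->; rewrite subrr.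
  move/(congr1 (fun u => Re (cval u (b - c)))); rewrite /= /om => h.
  have t0 := pf_starM_ge0 tau (val (b - c)).
  have s0 : 0 <= \sum_i phi i (star (val (b - c)) * val (b - c)).
    by apply: sumr_ge0 => i _; exact: pf_starM_ge0.
  by move: h t0 s0 => /=; lra.
have [E [[Eb El Ecp E1] Ebi Eid]] := wep_B (gns_star_rep B omega) pi_inj.
have [T [TM TE]] := compression B omega a.
have [h hP] := choice (fun i => radon_nikodym B (dom i)).
pose H := gns B omega; pose xi : H := embed (gns_form B omega) 1.
have Tb := opbound_bounded_op TM.
pose X := E T.
have [[Xl _] Xcomm] := Ebi _ Tb; rewrite -/X in Xl Xcomm.
have hX i u : h i (X u) = X (h i u).
  have [hM _ _ _ hpi] := hP i.
  have : commutant (range (gns_rep (B := B) (omega := omega))) (h i).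
    split; first exact: opbound_bounded_op hM.
    by move=> _ [b _ <-]; exact: hpi.
  by move/Xcomm/(congr1 (fun f => f u)).
have zero_b : bounded_op (0 : H -> H).
  apply: (@opbound_bounded_op _ _ _ _ 0); split.
    by move=> k u v; rewrite /= scaler0 addr0.
  move=> u; rewrite mul0r; have -> : (0 : H -> H) u = 0 by [].
  by rewrite /cnrm -[X in seminorm _ X](scale0r (0 : H)) seminormZ cabs0 mul0r.
have E0 : E 0 = 0.
  have := El 1 0 0 zero_b zero_b; rewrite !scale1r addr0 => /eqP.
  by rewrite -subr_eq0 opprD addNKr oppr_eq0 => /eqP.
pose z i (u : H) : H := (s i)%:C%C *: (gns_rep (d i) u - X u).
have zE i : z i = E (fun u => (s i)%:C%C *: (gns_rep (d i) u - T u)).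
  have gb := gns_rep_opbound omega (d i).
  pose k := (s i)%:C%C.
  have e1 : (fun u => k *: (gns_rep (d i) u - T u)) =
      (- k) *: T + (k *: gns_rep (d i) + 0) :> (H -> H).
    apply/funext => u.
    change (k *: (gns_rep (d i) u - T u) = (- k) *: T u + (k *: gns_rep (d i) u + 0)).
    lmod.
  have kb : bounded_op (k *: gns_rep (d i) + 0 : H -> H).
    rewrite addr0; exact: (opbound_bounded_op (opboundZ k gb)).
  rewrite e1 El // El //; last by case: (gns_star_rep B omega).
  rewrite E0 Eid; apply/funext => u.
  change (k *: (gns_rep (d i) u - X u) = (- k) *: X u + (k *: gns_rep (d i) u + 0)).
  lmod.
have zpos i u : 0 <= cdot (z i u) u.
  pose S u := (s i)%:C%C *: (gns_rep (d i) u - T u) : H.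
  have SM := opboundZ (s i)%:C%C (opboundB (gns_rep_opbound omega (d i)) TM).
  have Spos v : 0 <= cdot (S v) v.
    apply: (opbound_pos SM) => x.
    rewrite cdot_embedr cvalZ cvalD cvalN gns_rep_embed embedE TE /=.
    have [y ye] := sda i.
    rewrite -cfunN -cfunD -cfunZ.
    rewrite (_ : _ *: _ = star (y * val x) * (y * val x)); first exact: sq_ge0.
    rewrite starM -mulrA (mulrA (star y)) -ye -scalerAl -scalerAr mulrBl mulrBr.
    by rewrite mulrA.
  have := Ecp 1%N (fun _ _ => S) _ _ (fun _ => u).
  rewrite /opmx_pos !big_ord1 zE; apply.
    by move=> _ _; exact: opbound_bounded_op SM.
  by move=> v; rewrite !big_ord1; exact: Spos.
have zh i u : h i (z i u) = z i (h i u).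
  have [[hl _] _ _ _ hpi] := hP i.
  rewrite /z (linear_mapZ _ _ hl) (linear_mapB _ _ hl) hX.
  by have /(congr1 (fun f => f u)) /= -> := hpi (d i).
have zl i : linear (z i).
  have [gl _] := gns_rep_opbound omega (d i).
  move=> k u v; rewrite /z gl Xl; lmod.
have pos i : 0 <= Re (cdot (h i (z i xi)) xi).
  have [hM hE hs hpos hpi] := hP i.
  apply: (@commuting_pos _ _ (cdot_ip _) (h i) (z i) xi) => //; first exact: hM.1.
  - by move=> u; have /andP[] := hpos u.
  - move=> u; have /andP[p q] := hpos u.
    by have := q; rewrite lecE => /andP[_].
  - exact: zpos.
(* Moving [h j] to the other side of the inner product isolates [X], whose
   contributions cancel in the sum. *)
have term j : Re (cdot (h j (z j xi)) xi) =
    s j * phi j (val (d j)) - Re ((s j)%:C%C * cdot (X xi) (h j xi)).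
  have [hM hE hs hpos hpi] := hP j.
  rewrite /z hs cdotZl cdotBl mulrBr ReB; congr (_ - _).
  rewrite ReZ -hs gns_rep_embed mulr1 cdot_embedr hE /= star1 mul1r.
  by [].
have : 0 <= \sum_i Re (cdot (h i (z i xi)) xi) by exact: sumr_ge0.
rewrite (eq_bigr _ (fun i _ => term i)) big_split /= sumrN -Re_sum.
have -> : \sum_i (s i)%:C%C * cdot (X xi) (h i xi) =
    cdot (X xi) (\sum_i (s i)%:C%C *: h i xi).
  rewrite (big_morph (cdot (X xi)) (id1 := 0) (op1 := +%R)).
  - by apply: eq_bigr => i _; rewrite cdotZr conj_real.
  - by move=> u v; rewrite cdotDr.
  - exact: (ip0r (cdot_ip _)).
have -> : \sum_i (s i)%:C%C *: h i xi = 0.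
  apply: completionP => y.
  rewrite (big_morph (fun u : H => cval u y) (id1 := 0) (op1 := +%R)) //.
  transitivity (\sum_i (s i)%:C%C * cfun (phi i) (star (val y))).
    apply: eq_bigr => i _; have [_ hE _ _ _] := hP i.
    by rewrite cvalZ hE /= mulr1.
  rewrite cval0; apply/eqP; rewrite eq_complex Re_sum Im_sum; apply/andP; split.
    rewrite (eq_bigr (fun i => s i * phi i (val (star y)))); last first.
      by move=> i _; rewrite ReZ.
    by rewrite bal.
  rewrite (eq_bigr (fun i => - (s i * phi i (val ('i *: star y))))); last first.
    by move=> i _; rewrite ImZ /= mulrN.
  by rewrite sumrN bal oppr0.
have -> : cdot (X xi) 0 = 0 by exact: (ip0r (cdot_ip _)).
by rewrite subr0.
Qed.

Lemma subalg_pcone (b : subalg B) : pcone (val b) -> pcone b.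
Proof. by move=> [bs [t bt]]; split; [exact: val_inj | exists t]. Qed.

(** Separate the family [e_i = s_i d_i + delta] from the cone of all families
    [v] for which [Re v_i - s_i Re b] is positive for every [i], with a common [b]
    in [B].  A separating functional has positive components [psi_i]; since the
    cone contains the families [s_i b], these satisfy [sum_i s_i psi_i = 0] on
    [B], which [balanced_posfun_ge0] rules out. *)
Lemma interpolation (delta : R) : selfadjoint a -> 0 < delta ->
  exists beta : subalg B, selfadjoint beta /\
    forall i, pcone ((s i)%:C%C *: (d i - beta) + delta%:C%C *: 1).
Proof.
move=> a_sa delta0; apply: contrapT => no.
have sd_sa i : selfadjoint ((s i)%:C%C *: val (d i)).
  have [y ye] := sda i.
  rewrite (_ : _ *: _ = star y * y + (s i)%:C%C *: a).
    by apply: selfadjointD; [exact: selfadjoint_starM | exact: selfadjointZ].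
  by rewrite -ye; lmod.
(* Twice the real part; working with all of [A] instead of its self-adjoint part
   keeps the separation theorem within complex modules. *)
pose sym (x : A) := x + star x.
have symD x y : sym (x + y) = sym x + sym y by rewrite /sym starD; lmod.
have symZ t x : sym (t%:C%C *: x) = t%:C%C *: sym x by rewrite /sym starZR; lmod.
have sym_sa x : selfadjoint (sym x) by rewrite /sym /selfadjoint starD starK addrC.
pose K := [set v : I -> A | exists b : subalg B,
  forall i, pcone (sym (v i) - (s i)%:C%C *: sym (val b))].
pose e : I -> A := fun i => (s i)%:C%C *: val (d i) + delta%:C%C *: 1.
have K0 v : (forall i, pcone (sym (v i))) -> K v.
  move=> vP; exists 0 => i; rewrite (_ : sym (val _) = 0) ?scaler0 ?subr0 //.
  by rewrite /sym star0 addr0.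
have sym0 : sym 0 = 0 by rewrite /sym star0 addr0.
have cK : convex_cone K.
  split.
  - by apply: K0 => i; rewrite sym0; exact: pcone0.
  - move=> v w [b vb] [c wc]; exists (b + c) => i.
    rewrite (_ : _ - _ = (sym (v i) - (s i)%:C%C *: sym (val b)) +
      (sym (w i) - (s i)%:C%C *: sym (val c))); first exact: pconeD.
    have -> : val (b + c) = val b + val c by [].
    by have -> : (v + w) i = v i + w i by []; rewrite !symD; lmod.
  - move=> t v t0 [b vb]; exists (t%:C%C *: b) => i.
    rewrite (_ : _ - _ = t%:C%C *: (sym (v i) - (s i)%:C%C *: sym (val b))).
      exact: pconeZ.
    have -> : val (t%:C%C *: b) = t%:C%C *: val b by [].
    by have -> : (t%:C%C *: v) i = t%:C%C *: v i by []; rewrite !symZ; lmod.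
pose u : I -> A := fun=> 1.
have sym1 : sym 1 = (2 : R)%:C%C *: 1 by rewrite /sym star1; lmod.
have Ku : K u by apply: K0 => i; rewrite sym1; exact: pcone_scalar.
have unit v : exists t, K (t%:C%C *: u - v).
  pose t := \sum_i cnorm (sym (v i)); exists t; apply: K0 => i.
  have t1 : cnorm (sym (v i)) <= t.
    by rewrite /t (bigD1 i) //= lerDl sumr_ge0 // => j _; exact: cnorm_ge0.
  have t0 : 0 <= t := le_trans (cnorm_ge0 _) t1.
  rewrite (_ : sym _ = ((cnorm (sym (v i)))%:C%C *: 1 - sym (v i)) +
    (t + (t - cnorm (sym (v i))))%:C%C *: 1); last first.
    have -> : (t%:C%C *: u - v) i = t%:C%C *: 1 + (- v i) by [].
    rewrite symD symZ sym1 (_ : sym (- v i) = - sym (v i)); last first.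
      by rewrite /sym starN; lmod.
    by lmod.
  apply: pconeD; first exact: pcone_cnorm.
  by apply: pcone_scalar; rewrite addr_ge0 // subr_ge0.
have Ke : ~ K e.
  move=> [b eb]; apply: no.
  exists ((2^-1)%:C%C *: (b + star b)); split.
    by apply: selfadjointZ; rewrite /selfadjoint starD starK addrC.
  move=> i; apply: subalg_pcone.
  have half0 : 0 <= 2^-1 :> R by rewrite invr_ge0.
  have := pconeZ half0 (eb i); rewrite scalerBr (_ : sym (e i) = (2 : R)%:C%C *: e i).
    rewrite scalerA -rmorphM /= mulVf // scale1r /e; congr pcone.
    by rewrite [sym _]/(_ + _) scalerBr !scalerDr; lmod.
  rewrite /sym (_ : star (e i) = e i); first by lmod.
  exact: (selfadjointD (sd_sa i) (scalar_sa A delta)).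
have [phi [phiD phiZ phiK phi1 phie]] := cone_separation cK Ku unit Ke.
pose single i (x : A) : I -> A := fun j => if j == i then x else 0.
have singleD i x y : single i (x + y) = single i x + single i y.
  apply/funext => j.
  have -> : (single i x + single i y) j = single i x j + single i y j by [].
  by rewrite /single; case: (j == i); rewrite ?addr0.
have singleZ i k x : single i (k *: x) = k *: single i x.
  apply/funext => j; have -> : (k *: single i x) j = k *: single i x j by [].
  by rewrite /single; case: (j == i); rewrite ?scaler0.
have psiD i x y : phi (single i (x + y)) = phi (single i x) + phi (single i y).
  by rewrite singleD phiD.
have psiZ i t x : phi (single i (t%:C%C *: x)) = t * phi (single i x).
  by rewrite singleZ phiZ.
have psiP i x : pcone (x + star x) -> 0 <= phi (single i x).
  move=> xP; apply/phiK/K0 => j; rewrite /single; case: (j == i) => //.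
  by rewrite sym0; exact: pcone0.
pose psi i := sval (posfun_of (psiD i) (psiZ i) (psiP i)).
have psiE i x : psi i x = phi (single i x) by rewrite /psi; case: posfun_of.
have phi0 : phi 0 = 0 by have := phiD 0 0; rewrite addr0; lra.
have phiE v : phi v = \sum_i psi i (v i).
  rewrite (eq_bigr (fun i => phi (single i (v i)))) => [|i _]; last exact: psiE.
  rewrite -(big_morph phi phiD phi0); congr phi; apply/funext => j.
  rewrite fct_sumE (bigD1 j) //= {1}/single eqxx big1 ?addr0 // => i ij.
  by rewrite /single eq_sym (negbTE ij).
have bal_ge0 (b : subalg B) : 0 <= phi (fun i => (s i)%:C%C *: val b).
  by apply: phiK; exists b => i; rewrite symZ subrr; exact: pcone0.
have bal (b : subalg B) : \sum_i s i * psi i (val b) = 0.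
  have E (c : subalg B) :
      phi (fun i => (s i)%:C%C *: val c) = \sum_i s i * psi i (val c).
    by rewrite phiE; apply: eq_bigr => i _; rewrite pfZ.
  have := bal_ge0 b; have := bal_ge0 (- b); rewrite !E.
  rewrite (eq_bigr (fun i => - (s i * psi i (val b)))); last first.
    by move=> i _; have -> : val (- b) = - val b by []; rewrite pfN mulrN.
  by rewrite sumrN; lra.
have := balanced_posfun_ge0 bal.
have : phi e = \sum_i s i * psi i (val (d i)) + delta.
  rewrite -[X in _ + X]mulr1 -phi1 !phiE mulr_sumr -big_split.
  by apply: eq_bigr => i _; rewrite /= pfD !pfZ.
by move: phie delta0; lra.
Qed.

End Interpolation.

(** * Diagonal sequences *)

Section LimitBounds.
Variable R : realType.
Implicit Types (u : nat -> R) (l : R).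

Lemma limn_esup_le u l :
  (forall r : R, 0 < r -> exists N, forall n, (N <= n)%N -> u n <= l + r) ->
  (limn_esup (fun n => (u n)%:E) <= l%:E)%E.
Proof.
move=> h; apply/lee_addgt0Pr => r r0; have [N hN] := h r r0.
apply: (@le_trans _ _ (ereal_sup [set (u n)%:E | n in [set n | (N <= n)%N]])).
  by apply: ereal_inf_lbound; exists [set n | (N <= n)%N] => //; exists N.
by apply: ge_ereal_sup => _ [n Nn <-]; rewrite -EFinD lee_fin hN.
Qed.

Lemma limn_einf_ge u l :
  (forall r : R, 0 < r -> exists N, forall n, (N <= n)%N -> l - r <= u n) ->
  (l%:E <= limn_einf (fun n => (u n)%:E))%E.
Proof.
move=> h; rewrite /limn_einf leeNr -EFinN.
apply: (@limn_esup_le (fun n => - u n)) => r /h[N hN]; exists N => n /hN.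
by rewrite lerNl opprD opprK; congr (_ <= _); ring.
Qed.

End LimitBounds.

Section States.
Variables (R : realType) (C : cstarType R) (psi : {scalar C}).
Hypothesis psi_state : is_state psi.

Lemma pcone_cstar_pos (x : C) : pcone x -> cstar_pos x.
Proof. by move=> /pcone_sqrt[u [us <- _ _]]; exists u; rewrite us. Qed.

Lemma state_ge0 (x : C) : pcone x -> 0 <= Re (psi x).
Proof. by move=> /pcone_cstar_pos/psi_state.1/ge0_Re. Qed.

Lemma Re_state_scalar (t : R) : Re (psi (t%:C%C *: 1)) = t.
Proof. by rewrite linearZ /= psi_state.2 mulr1. Qed.

Lemma state_le_cnorm (x : C) : selfadjoint x -> Re (psi x) <= cnorm x.
Proof.
move=> /pcone_cnorm/state_ge0; rewrite linearB ReB Re_state_scalar.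
by rewrite subr_ge0.
Qed.

End States.

Section Sandwich.
Variables (R : realType) (A : cstarType R) (B : cstarSubalg A).
Variable a : A.
Hypothesis a_sa : selfadjoint a.

Local Ltac lmod := lmod_over (R[i] : comNzRingType).

(** Upper and lower bounds of [a] are treated together, a lower bound [c] being
    recorded as [- (c - a) >= 0]. *)
Definition sgn (up : bool) : R := if up then 1 else - 1.

Definition bounds up (c : subalg B) :=
  cstar_pos ((sgn up)%:C%C *: (val c - a)).

Lemma sgnM up : (sgn up)%:C%C * (sgn up)%:C%C = 1 :> R[i].
Proof. by case: up; rewrite /sgn ?rmorphN /= ?mulrNN mulr1. Qed.

Lemma bounds_sa up c : bounds up c -> selfadjoint c.
Proof.
move=> [y ye]; apply: val_inj => /=.
have -> : val c = (sgn up)%:C%C *: (star y * y) + a.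
  by rewrite -ye scalerA sgnM scale1r subrK.
by apply: selfadjointD => //; apply: selfadjointZ; exact: selfadjoint_starM.
Qed.

Lemma bounds_cnorm up : bounds up ((sgn up * cnorm a)%:C%C *: 1).
Proof.
apply: pcone_cstar_pos.
have -> : (sgn up)%:C%C *: (val ((sgn up * cnorm a)%:C%C *: (1 : subalg B)) - a) =
    (cnorm a)%:C%C *: 1 - (sgn up)%:C%C *: a.
  have -> : val ((sgn up * cnorm a)%:C%C *: (1 : subalg B)) =
    (sgn up * cnorm a)%:C%C *: 1 by [].
  by rewrite scalerBr scalerA rmorphM /= mulrA sgnM mul1r.
rewrite -[cnorm a](_ : cnorm ((sgn up)%:C%C *: a) = _).
  by apply: pcone_cnorm; exact: selfadjointZ.
by rewrite cnormZR /sgn; case: up; rewrite ?normrN normr1 mul1r.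
Qed.

(** From a dense sequence [e_i] of [B], select for each radius [1 / (j + 1)] a
    bound within that distance of [e_i] whenever there is one, and the scalar
    bound otherwise. *)
Lemma dense_bounds : cstar_separable (subalg B) ->
  exists D : nat -> nat -> bool -> subalg B,
    (forall i j up, bounds up (D i j up)) /\
    forall up c, bounds up c -> forall r : R, 0 < r ->
      exists i j, cnorm (D i j up - c) < r.
Proof.
move=> /separable_sequence[e eD].
have pick (t : nat * nat * bool) : exists d, bounds t.2 d /\
   ((exists2 c, bounds t.2 c & cnorm (c - e t.1.1) < t.1.2.+1%:R^-1) ->
    cnorm (d - e t.1.1) < t.1.2.+1%:R^-1).
  have [[c cb ce]|no] := pselect
      (exists2 c, bounds t.2 c & cnorm (c - e t.1.1) < t.1.2.+1%:R^-1).
    by exists c.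
  by exists ((sgn t.2 * cnorm a)%:C%C *: 1); split; first exact: bounds_cnorm.
have [D hD] := choice pick.
exists (fun i j up => D (i, j, up)); split.
  by move=> i j up; exact: (hD (i, j, up)).1.
move=> up c cb r r0; have r2 : 0 < r / 2 by rewrite divr_gt0.
have [j /(_ j (leqnn j)) jr] := inv_small r2.
have j0 : 0 < j.+1%:R^-1 :> R by rewrite invr_gt0.
have [i ci] := eD c _ j0; exists i, j.
have /= := (hD (i, j, up)).2 (ex_intro2 _ _ c cb ci).
set d := D _ => di; have := ler_cnormB (d - e i) (c - e i).
rewrite opprB addrA subrK => /le_lt_trans; apply.
have aux (p q t : R) : t < r / 2 -> p < t -> q < t -> p + q < r by lra.
exact: (aux _ _ _ jr).
Qed.

End Sandwich.

Theorem theorem1p4 (R : realType) (A : cstarType R) (B : cstarSubalg A)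
    (separable_B : cstar_separable (subalg B))
    (wep_B : weak_expectation_property (subalg B))
    (a : A) (a_sa : selfadjoint a) (eps : R) (eps_gt0 : 0 < eps) :
  exists beta : nat -> subalg B,
    [/\ forall n, selfadjoint (beta n),
        (forall n, cnorm (beta n) <= (1 + eps) * cnorm a) /\
        (limn_esup (fun n => (cnorm (beta n))%:E) <= (cnorm a)%:E)%E
      & forall psi : {scalar (subalg B)}, is_state psi ->
          (limn_esup (fun n => (complex.Re (psi (beta n)))%:E) <=
           ereal_inf [set (complex.Re (psi b))%:E |
                      b in [set b : subalg B | cstar_le a (val b)]])%E /\
          (ereal_sup [set (complex.Re (psi c))%:E |
                      c in [set c : subalg B | cstar_le (val c) a]] <=
           limn_einf (fun n => (complex.Re (psi (beta n)))%:E))%E].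
Proof.
have leE c : cstar_le a (val c) -> bounds a true c.
  by rewrite /bounds /sgn /cstar_le rmorph1 scale1r.
have geE c : cstar_le (val c) a -> bounds a false c.
  by rewrite /bounds /sgn /cstar_le rmorphN rmorph1 scaleN1r opprB.
suff [beta [beta_sa beta_norm beta_lim beta_state]] : exists beta : nat -> subalg B,
    [/\ forall n, selfadjoint (beta n),
        forall n, cnorm (beta n) <= (1 + eps) * cnorm a,
        forall r : R, 0 < r -> exists N, forall n, (N <= n)%N ->
          cnorm (beta n) <= cnorm a + r
      & forall psi : {scalar (subalg B)}, is_state psi ->
          forall up c, bounds a up c -> forall r : R, 0 < r ->
          exists N, forall n, (N <= n)%N ->
            sgn R up * Re (psi (beta n)) <= sgn R up * Re (psi c) + r].
  exists beta; split => //; first by split => //; exact: limn_esup_le.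
  move=> psi psi_st; split.
    apply: le_ereal_inf_tmp => _ [c /leE cb <-]; apply: limn_esup_le => r r0.
    have [N hN] := beta_state psi psi_st true c cb r r0.
    by exists N => n /hN; rewrite /sgn !mul1r.
  apply: ge_ereal_sup => _ [c /geE cb <-]; apply: limn_einf_ge => r r0.
  have [N hN] := beta_state psi psi_st false c cb r r0.
  by exists N => n /hN; rewrite /sgn !mulN1r; lra.
(* For [a = 0] the norm bound is [0] and leaves no room for an error term. *)
have [a0|a_neq0] := eqVneq a 0.
  exists (fun=> 0); split.
  - by move=> n; exact: selfadjoint0.
  - by move=> n; rewrite a0 !cnorm0 mulr0.
  - by move=> r r0; exists 0%N => n _; rewrite a0 !cnorm0 add0r ltW.
  - move=> psi psi_st up c [y]; rewrite a0 subr0 => yc r r0; exists 0%N => n _.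
    have : pcone ((sgn R up)%:C%C *: c).
      by apply: subalg_pcone; rewrite [val _]yc; exact: pcone_starM.
    move/(state_ge0 psi_st); rewrite linearZ /= linear0 mulr0 ReZ.
    by move=> h; rewrite addr_ge0 // ltW.
have an0 : 0 < cnorm a by rewrite lt_def cnorm_eq0 a_neq0 cnorm_ge0.
have [D [Db Dd]] := dense_bounds a_sa separable_B.
pose delta n : R := Num.min n.+1%:R^-1 (eps * cnorm a).
have delta_gt0 n : 0 < delta n by rewrite lt_min invr_gt0 ltr0n mulr_gt0.
have step n : exists beta : subalg B, [/\ selfadjoint beta,
    cnorm beta <= cnorm a + delta n &
    forall i j up, (i < n)%N -> (j < n)%N ->
      pcone ((sgn R up)%:C%C *: (D i j up - beta) + (delta n)%:C%C *: 1)].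
  (* The two indices on the right stand for the scalar bounds. *)
  pose I := (('I_n * 'I_n * bool) + bool)%type.
  pose s (t : I) := match t with inl p => sgn R p.2 | inr up => sgn R up end.
  pose d (t : I) := match t with inl p => D p.1.1 p.1.2 p.2
    | inr up => (sgn R up * cnorm a)%:C%C *: 1 end.
  have sda t : cstar_pos ((s t)%:C%C *: (val (d t) - a)).
    by case: t => [[[i j] up]|up]; [exact: Db | exact: bounds_cnorm].
  have [beta [bs bP]] := interpolation separable_B wep_B sda a_sa (delta_gt0 n).
  exists beta; split => //.
    have bT := bP (inr true); have bF := bP (inr false).
    apply: pcone_cnorm_le => //.
      move: bT; congr pcone; rewrite /= /sgn mul1r !rmorphD /= rmorph1 scale1r.
      lmod_over (R[i] : comNzRingType).
    move: bF; congr pcone; rewrite /= /sgn mulN1r !rmorphD !rmorphN /= rmorph1.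
    lmod_over (R[i] : comNzRingType).
  by move=> i j up ni nj; exact: (bP (inl (Ordinal ni, Ordinal nj, up))).
have [beta hbeta] := choice step.
have dle n : delta n <= n.+1%:R^-1 by rewrite ge_min lexx.
exists beta; split.
- by move=> n; case: (hbeta n).
- move=> n; have [_ h _] := hbeta n; rewrite (le_trans h) // mulrDl mul1r lerD2l.
  by rewrite ge_min lexx orbT.
- move=> r r0; have [N hN] := inv_small r0; exists N => n Nn.
  have [_ h _] := hbeta n; rewrite (le_trans h) // lerD2l (le_trans (dle n)) //.
  exact/ltW/hN.
- move=> psi psi_st up c cb r r0; have r2 : 0 < r / 2 by rewrite divr_gt0.
  have [i [j /ltW ij]] := Dd up c cb _ r2; have [N hN] := inv_small r2.
  exists (maxn N (maxn i j).+1) => n; rewrite geq_max => /andP[Nn].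
  rewrite gtn_max => /andP[ni nj].
  have [_ _ /(_ i j up ni nj)/(state_ge0 psi_st)] := hbeta n.
  rewrite linearD linearZ linearB ReD ReZ ReB (Re_state_scalar psi_st).
  have sa1 : selfadjoint ((sgn R up)%:C%C *: (D i j up - c)).
    apply/selfadjointZ/selfadjointB; last exact: bounds_sa cb.
    exact: bounds_sa (Db i j up).
  have := state_le_cnorm psi_st sa1.
  rewrite linearZ linearB ReZ ReB cnormZR.
  have -> : `|sgn R up| = 1 by case: (up); rewrite /sgn ?normrN normr1.
  rewrite mul1r => h2 h1; have h3 := le_trans (dle n) (ltW (hN n Nn)).
  have aux (g x y z t q : R) : 0 <= g * (x - y) + t -> g * (x - z) <= q ->
    q <= r / 2 -> t <= r / 2 -> g * y <= g * z + r by lra.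
  exact: aux h1 h2 ij h3.
Qed.
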